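(* Let $\mathcal O$ be a commutative integral domain whose field of fractions has characteristic zero, and let $X=X_{\bar0}\oplus X_{\bar1}$ be an $\mathcal O$-superalgebra which is free of finite rank as an $\mathcal O$-supermodule. Let $Y=X_{\bar1}\oplus X^*\subseteq T_X$ and let $1=1_X$. For any integer $d>0$, the $\mathcal O$-superalgebra $\mathcal D^dX$ is generated by $\mathrm{Inv}^dX_{\bar0}$ and $1^{\otimes(d-1)}*Y$.
   Context: $\bar v$ is the parity of a homogeneous element $v$ of a $\mathbb Z_2$-graded module, $\mathbb Z_2=\{\bar0,\bar1\}$; formulas with parities are for homogeneous elements, extended linearly. Superalgebras are associative, unital, $\mathbb Z_2$-graded; free of finite rank as a supermodule means both parity components are free of finite rank. $X^*=\mathrm{Hom}_{\mathcal O}(X,\mathcal O)$ is an $X$-bimodule by $\langle\alpha\cdot a,b\rangle=\langle\alpha,ab\rangle$, $\langle b,a\cdot\alpha\rangle=\langle ba,\alpha\rangle$, and $T_X=X\oplus X^*$ is the superalgebra with $(a,\alpha)(b,\beta)=(ab,a\cdot\beta+\alpha\cdot b)$. $T_X^{\otimes d}$ is a superalgebra via $(x_1\otimes\cdots\otimes x_d)(y_1\otimes\cdots\otimes y_d)=(-1)^{\sum_{a<c}\bar x_c\bar y_a}x_1y_1\otimes\cdots\otimes x_dy_d$. The symmetric group $\mathfrak S_d$ acts on the right on $V^{\otimes d}$ for a $\mathbb Z_2$-graded module $V$ by $(v_1\otimes\cdots\otimes v_d)^g=(-1)^mv_{g1}\otimes\cdots\otimes v_{gd}$, $m=\sum_{a<c,\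 g^{-1}a>g^{-1}c}\bar v_a\bar v_c$. $\mathrm{Inv}^dV=(V^{\otimes d})^{\mathfrak S_d}$; $\mathrm{Inv}^dT_X$ is a subsuperalgebra of $T_X^{\otimes d}$. The shuffle product is $s*t=\sum_g(s\otimes t)^g$ for $s\in V^{\otimes d},t\in V^{\otimes e}$, $g$ running over shortest coset representatives for $(\mathfrak S_d\times\mathfrak S_e)\backslash\mathfrak S_{d+e}$. $\mathrm{Star}^eV$ is the $\mathcal O$-span of all $v_1*\cdots*v_e$, $v_i\in V$. For submodules $P,Q$, $P*Q$ is the span of all $p*q$. $\mathcal D^dX\subseteq\mathrm{Inv}^dT_X$ is the image of the degree $d$ Turner double $D^dX=\bigoplus_{e=0}^d\mathrm{Inv}^{d-e}X\otimes\mathrm{Sym}^e(X^* )$ (where $\mathrm{Sym}$ is the symmetric superalgebra) under the injective superalgebra homomorphism $\xi\otimes x_1\cdots x_e\mapsto\xi*x_1*\cdots*x_e$ ($\xi\in\mathrm{Inv}^{d-e}X$, $x_i\in X^*$). Explicitly, $\mathcal D^dX=\bigoplus_{e=0}^d\mathrm{Inv}^{d-e}(X)*\mathrm{Star}^e(X^* )$, a unital subsuperalgebra of $\mathrm{Inv}^dT_X$. *)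

(* Defs.v *)
From HB Require Import structures.
From mathcomp Require Import all_boot all_order all_fingroup all_algebra.

Set Implicit Arguments.
Unset Strict Implicit.
Unset Printing Implicit Defensive.

Import GRing.Theory.
Local Open Scope ring_scope.

(* A supermodule V whose two parity components are free of finite rank, given
   by bases of these: the component of parity e (true is odd) is free on the
   bas i with par i = e; dbas is the dual basis of V^*. *)
Record supermodule (O : comNzRingType) := Supermodule {
  smod_sort :> vectType O;
  idx : finType;
  par : idx -> bool;
  bas : idx -> smod_sort;
  dbas : idx -> 'Hom(smod_sort, O^o);
  dbas_bas : forall i j, dbas i (bas j) = (i == j)%:R;
  bas_sum : forall v, v = \sum_i dbas i v *: bas i }.

Arguments par {O s} i.
Arguments bas {O s} i.
Arguments dbas {O s} i.

Definition hom (O : comNzRingType) (V : supermodule O) (e : bool) (v : V) :=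
  forall i, par i != e -> dbas i v = 0.

Record superalgebra (O : comNzRingType) := Superalgebra {
  salg_smod :> supermodule O;
  smul : salg_smod -> salg_smod -> salg_smod;
  sone : salg_smod;
  smulA : associative smul;
  smul1l : left_id sone smul;
  smul1r : right_id sone smul;
  smul_linl : forall y, linear (smul^~ y);
  smul_linr : forall x, linear (smul x);
  sone_hom : hom false sone;
  smul_hom : forall e f x y, hom e x -> hom f y -> hom (e (+) f) (smul x y) }.

Arguments sone {O s}.
Arguments smul {O s}.
Arguments sone_hom {O} s.
Arguments smul_hom {O s e f x y}.
Notation "x ** y" := (smul x y) (at level 40, left associativity).

Definition lspan (O : comNzRingType) (V : lmodType O) (S : V -> Prop) (v : V) :=
  exists n (c : 'I_n -> O) (s : 'I_n -> V),
    (forall i, S (s i)) /\ v = \sum_i c i *: s i.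

(* As for subsuperalgebras: when S is spanned by homogeneous elements, so is
   the subalgebra it generates. *)
Definition subalgebra (O : comNzRingType) (A : superalgebra O)
    (P : A -> Prop) :=
  [/\ P sone, (forall c x y, P x -> P y -> P (c *: x + y))
    & (forall x y, P x -> P y -> P (x ** y))].

Definition subalg_gen (O : comNzRingType) (A : superalgebra O)
    (S : A -> Prop) (x : A) :=
  forall P, subalgebra P -> (forall y, S y -> P y) -> P x.

Section TensorPower.
Variables (O : comNzRingType) (V : supermodule O).

Definition word d := {ffun 'I_d -> idx V}.

(* V^{(x) d}, a tensor being given by its coordinates in the basis
   bas (w 0) (x) ... (x) bas (w (d-1)) indexed by words w; its universal
   property is tensor_universal.  The action and the products are defined by
   linear extension from this basis; tact_pure, tprod_pure and tmul_pure give
   their values on all pure tensors of homogeneous elements. *)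
Definition tensor d := {ffun word d -> O^o}.

Definition pure d (v : 'I_d -> V) : tensor d :=
  [ffun w : word d => \prod_a dbas (w a) (v a)].

Definition bast d (w : word d) : tensor d := pure (fun a => bas (w a)).

Definition parw d (w : word d) : bool := odd (\sum_a par (w a))%N.

Definition act_sgn d (g : 'S_d) (p : 'I_d -> bool) : nat :=
  (\sum_(a < d) \sum_(c < d | (a < c) && (g^-1%g c < g^-1%g a)) p a * p c)%N.

Definition tact d (t : tensor d) (g : 'S_d) : tensor d :=
  \sum_w t w *: ((-1) ^+ act_sgn g (par \o w) *:
                 pure (fun a => bas (w (g a)))).

Definition tprod m n (s : tensor m) (t : tensor n) : tensor (m + n) :=
  [ffun w : word (m + n) => s [ffun a => w (lshift n a)] *
                            t [ffun a => w (rshift m a)]].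

(* The Coxeter length, as the number of inversions. *)
Definition perm_length n (g : 'S_n) : nat :=
  #|[set ac : 'I_n * 'I_n | (ac.1 < ac.2)%N && (g ac.2 < g ac.1)%N]|.

Definition young m n (h : 'S_(m + n)) : bool :=
  [forall i, (h i < m)%N == (i < m)%N].

(* Permutations are composed from right to left in the coset
   (S_m x S_n) g, whence the product g * h, which maps i to h (g i). *)
Definition shortest m n (g : 'S_(m + n)) : bool :=
  [forall h, young h ==> (perm_length g <= perm_length (g * h)%g)%N].

Definition shuffle m n (s : tensor m) (t : tensor n) : tensor (m + n) :=
  \sum_(g : 'S_(m + n) | shortest g) tact (tprod s t) g.

Fixpoint star e : ('I_e -> V) -> tensor e :=
  match e with
  | 0 => fun v => pure v
  | e'.+1 => fun v => shuffle (pure (fun _ : 'I_1 => v ord0))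
                              (star (fun i => v (lift ord0 i)))
  end.

Definition tcast m n (eq_mn : m = n) (t : tensor m) : tensor n :=
  ecast k (tensor k) eq_mn t.

(* For a direct summand P of V, the tensor power of P inside that of V. *)
Definition tpow (P : V -> Prop) d : tensor d -> Prop :=
  lspan (fun t => exists2 v, forall a, P (v a) & t = pure v).

Definition Inv (P : V -> Prop) d (t : tensor d) : Prop :=
  tpow P t /\ forall g, tact t g = t.

Definition Star (P : V -> Prop) e : tensor e -> Prop :=
  lspan (fun t => exists2 v, forall a, P (v a) & t = star v).

End TensorPower.

Arguments pure {O V d}.
Arguments bast {O V d}.

Lemma lin_props (R : nzRingType) (W W' : lmodType R) (f : W -> W') : linear f ->
  [/\ f 0 = 0, (forall x y, f (x + y) = f x + f y),
      (forall c x, f (c *: x) = c *: f x) &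
      (forall I (r : seq I) (P : pred I) F,
         f (\sum_(i <- r | P i) F i) = \sum_(i <- r | P i) f (F i))].
Proof.
move=> lf.
have fD x y : f (x + y) = f x + f y by have := lf 1 x y; rewrite !scale1r.
have f0 : f 0 = 0 by apply: (addIr (f 0)); rewrite -fD addr0 add0r.
split=> // [c x|I r P F]; first by have := lf c x 0; rewrite !addr0 f0 addr0.
exact: (big_morph f).
Qed.

Lemma linfunE (R : comNzRingType) (W W' : vectType R) (f : W -> W') :
  linear f -> linfun f =1 f.
Proof.
move=> lf; pose L := GRing.isLinear.Build R W W' *:%R f lf.
pose g : {linear W -> W'} := HB.pack f L.
exact: (lfunE g).
Qed.

Section TensorFacts.
Variables (O : comNzRingType) (V : supermodule O).

Lemma bastE d (w u : word V d) : bast w u = (u == w)%:R.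
Proof.
rewrite ffunE; under eq_bigr do rewrite dbas_bas.
have [->|neq] := eqVneq u w; first by rewrite big1 // => a _; rewrite eqxx.
have /existsP[a na] : [exists a, u a != w a].
  rewrite -[X in is_true X]negbK; apply/negP => /existsPn h.
  by case/eqP: neq; apply/ffunP => a; apply/eqP; rewrite -[_ == _]negbK h.
by rewrite (bigD1 a) //= (negPf na) mul0r.
Qed.

Lemma tensor_sum d (t : tensor V d) : t = \sum_w t w *: bast w.
Proof.
apply/ffunP => u; rewrite sum_ffunE (bigD1 u) //= big1 => [|w nwu].
  by rewrite addr0 [RHS]ffunE bastE eqxx [RHS]mulr1.
by rewrite ffunE bastE eq_sym (negPf nwu) scaler0.
Qed.

Lemma pure_sum d (v : 'I_d -> V) :
  pure v = \sum_(w : word V d) (\prod_a dbas (w a) (v a)) *: bast w.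
Proof. by rewrite {1}[pure v]tensor_sum; apply: eq_bigr => w _; rewrite ffunE. Qed.

Definition multilinear d (W : lmodType O) (F : ('I_d -> V) -> W) :=
  (forall v v', v =1 v' -> F v = F v') /\
  (forall (a : 'I_d) v c x y,
     F (fun i => if i == a then c *: x + y else v i) =
     c *: F (fun i => if i == a then x else v i) +
     F (fun i => if i == a then y else v i)).

Lemma pure_multilinear d : multilinear (@pure O V d).
Proof.
split=> [v v' eqv|a v c x y]; apply/ffunP => w.
  by rewrite !ffunE; apply: eq_bigr => i _; rewrite eqv.
have pE z : pure (fun i => if i == a then z else v i) w =
    dbas (w a) z * \prod_(i | i != a) dbas (w i) (v i).
  rewrite ffunE (bigD1 a) //= eqxx; congr (_ * _).
  by apply: eq_bigr => i /negPf ->.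
have -> (s t : tensor V d) : (c *: s + t) w = c * s w + t w.
  by rewrite ffunE [X in X + _]ffunE.
rewrite !pE; set r := \prod_(i | _) _.
have -> : dbas (w a) (c *: x + y) = c * dbas (w a) x + dbas (w a) y.
  exact: linearP.
by rewrite mulrDl mulrA.
Qed.

Lemma multilinear_comp d (W W' : lmodType O) (F : ('I_d -> V) -> W)
    (f : W -> W') : multilinear F -> linear f -> multilinear (f \o F).
Proof.
case=> F_ext F_lin lf; split=> [v v' /F_ext /= -> // | a v c x y] /=.
by rewrite F_lin lf.
Qed.

Lemma multilinear_eq d (W : lmodType O) (F G : ('I_d -> V) -> W) :
  multilinear F -> multilinear G ->
  (forall w : word V d, F (fun a => bas (w a)) = G (fun a => bas (w a))) ->
  F =1 G.
Proof.
move=> mF mG eqFG.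
suff h k (v : 'I_d -> V) :
    (forall a : 'I_d, (k <= a)%N -> exists i, v a = bas i) -> F v = G v.
  by move=> v; apply: (h d) => a; rewrite leqNgt ltn_ord.
elim: k v => [|k IHk] v vP.
  have /(_ _)/sigW-/all_sig[w wE] a : exists i, v a == bas i.
    by have [i ->] := vP a isT; exists i.
  have vE : v =1 (fun a => bas ((finfun w : word V d) a)).
    by move=> a; rewrite ffunE; apply/eqP.
  by rewrite (mF.1 _ _ vE) (mG.1 _ _ vE) eqFG.
have [ltkd|ledk] := ltnP k d; last first.
  by apply: IHk => a lea; move: (ltn_ord a); rewrite ltnNge (leq_trans ledk).
pose a := Ordinal ltkd.
pose upd x i := if i == a then x else v i.
have vE : v =1 upd (\sum_i dbas i (v a) *: bas i).
  by move=> i; rewrite /upd -bas_sum; case: eqP => [->|].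
have lin (H : ('I_d -> V) -> W) : multilinear H -> linear (fun x => H (upd x)).
  by move=> mH c x y; rewrite -mH.2.
rewrite (mF.1 _ _ vE) (mG.1 _ _ vE).
have [_ _ FZ FS] := lin_props (lin F mF); have [_ _ GZ GS] := lin_props (lin G mG).
rewrite FS GS; apply: eq_bigr => i _; rewrite FZ GZ; congr (_ *: _).
apply: IHk => j lekj; rewrite /upd; case: (eqVneq j a) => [_|nja].
  by exists i.
by apply: vP; rewrite ltn_neqAle lekj andbT eq_sym; apply: contra nja.
Qed.

Lemma multilinear_expand d (W : lmodType O) (F : ('I_d -> V) -> W) v :
  multilinear F ->
  F v = \sum_(w : word V d) (\prod_a dbas (w a) (v a)) *: F (fun a => bas (w a)).
Proof.
move=> mF; pose f (t : tensor V d) := \sum_w t w *: F (fun a => bas (w a)).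
have lf : linear f.
  move=> c s t; rewrite scaler_sumr -big_split; apply: eq_bigr => w _ /=.
  have -> : (c *: s + t) w = c * s w + t w by rewrite ffunE [X in X + _]ffunE.
  by rewrite scalerDl scalerA.
have fE (t : 'I_d -> V) : f (pure t) =
    \sum_(w : word V d) (\prod_a dbas (w a) (t a)) *: F (fun a => bas (w a)).
  by apply: eq_bigr => w _; rewrite ffunE.
rewrite -fE; have mG := multilinear_comp (pure_multilinear d) lf.
have h := multilinear_eq mF mG _ v.
apply: h => u /=; rewrite /f (bigD1 u) //= big1 => [|w nwu].
  by rewrite bastE eqxx scale1r addr0.
by rewrite bastE (negPf nwu) scale0r.
Qed.

Lemma tensor_universal d (W : lmodType O) (F : ('I_d -> V) -> W) :
  multilinear F ->
  exists2 f : tensor V d -> W, linear f /\ (forall v, f (pure v) = F v) &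
    forall f', linear f' -> (forall v, f' (pure v) = F v) -> f' =1 f.
Proof.
move=> mF; exists (fun t : tensor V d => \sum_w t w *: F (fun a => bas (w a))).
  split=> [c s t|v]; last first.
    by rewrite (multilinear_expand v mF); apply: eq_bigr => w _; rewrite ffunE.
  rewrite scaler_sumr -big_split; apply: eq_bigr => w _ /=.
  have -> : (c *: s + t) w = c * s w + t w by rewrite ffunE [X in X + _]ffunE.
  by rewrite scalerDl scalerA.
move=> f' lf' f'E t; have [_ _ fZ f_sum] := lin_props lf'.
rewrite {1}[t]tensor_sum f_sum; apply: eq_bigr => w _.
by rewrite fZ f'E.
Qed.

Lemma dbas_hom e (v : V) i : hom e v -> dbas i v != 0 -> par i = e.
Proof.
move=> hv nz; apply/eqP; rewrite -[_ == _]negbK; apply/negP => ne.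
by move: nz; rewrite hv ?eqxx.
Qed.

Lemma tact_pure d (v : 'I_d -> V) (p : 'I_d -> bool) (g : 'S_d) :
  (forall a, hom (p a) (v a)) ->
  tact (pure v) g = (-1) ^+ act_sgn g p *: pure (fun a => v (g a)).
Proof.
move=> vp.
have mF : multilinear (fun v : 'I_d -> V => pure (fun a => v (g a))).
  split=> [u u' equ|a u c x y].
    by apply: (pure_multilinear d).1 => a; rewrite equ.
  have E z : pure (fun i => if g i == a then z else u (g i)) =
      pure (fun i => if i == (g^-1)%g a then z else u (g i)).
    apply: (pure_multilinear d).1 => i.
    by rewrite -(inj_eq (@perm_inj _ g) i) permKV.
  by rewrite !E (pure_multilinear d).2.
rewrite (multilinear_expand v mF) scaler_sumr; apply: eq_bigr => w _.
rewrite ffunE !scalerA mulrC.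
have [-> | nz] := eqVneq (\prod_a dbas (w a) (v a)) 0; first by rewrite !mulr0.
congr ((_ ^+ _ * _) *: _); apply: eq_bigr => a _; apply: eq_bigr => c _ /=.
suff wp i : par (w i) = p i by rewrite !wp.
apply: dbas_hom (vp i) _; apply: contraNneq nz => z0.
by rewrite (bigD1 i) //= z0 mul0r.
Qed.

Lemma tprod_pure m n (u : 'I_m -> V) (v : 'I_n -> V) :
  tprod (pure u) (pure v) =
  pure (fun i => match split i with inl a => u a | inr b => v b end).
Proof.
apply/ffunP => w; rewrite !ffunE big_split_ord /=; congr (_ * _);
  apply: eq_bigr => a _; rewrite ffunE.
  by have := unsplitK (inl a : 'I_m + 'I_n) => /= ->.
by have := unsplitK (inr a : 'I_m + 'I_n) => /= ->.
Qed.

End TensorFacts.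

Section TensorAlgebra.
Variables (O : comNzRingType).

Lemma sum_linear (W : lmodType O) (I : finType) (F G H : I -> W) c :
  (forall i, F i = c *: G i + H i) ->
  \sum_i F i = c *: \sum_i G i + \sum_i H i.
Proof.
by move=> E; rewrite scaler_sumr -big_split; apply: eq_bigr => i _ /=.
Qed.

Section Smod.
Variables (V : supermodule O) (d : nat).

Lemma tensor_linE c (s t : tensor V d) w : (c *: s + t) w = c * (s w : O) + (t w : O) :> O.
Proof. by rewrite ffunE [X in X + _]ffunE. Qed.

Definition dbast (w : word V d) : 'Hom(tensor V d, O^o) :=
  linfun (fun t : tensor V d => t w).

Lemma dbastE w t : dbast w t = t w.
Proof. by apply: linfunE => c s u; rewrite tensor_linE. Qed.

Lemma dbast_bast (w u : word V d) : dbast w (bast u) = (w == u)%:R.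
Proof. by rewrite dbastE bastE. Qed.

Lemma bast_sum (t : tensor V d) : t = \sum_w dbast w t *: bast w.
Proof. by rewrite {1}[t]tensor_sum; apply: eq_bigr => w _; rewrite dbastE. Qed.

Definition tensor_smod : supermodule O :=
  Supermodule (@parw O V d) dbast_bast bast_sum.

Lemma tensor_linear_eq (W : lmodType O) (f g : tensor V d -> W) :
  linear f -> linear g -> (forall w, f (bast w) = g (bast w)) -> f =1 g.
Proof.
move=> /lin_props[_ _ fZ fS] /lin_props[_ _ gZ gS] fg t.
rewrite [t]tensor_sum fS gS; apply: eq_bigr => w _.
by rewrite fZ gZ fg.
Qed.

End Smod.

Lemma bas_hom (V : supermodule O) (i : idx V) : hom (par i) (bas i).
Proof. by move=> j; rewrite dbas_bas; case: (eqVneq j i) => // ->; rewrite eqxx. Qed.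
Arguments bas_hom {V} i.

Section Salg.
Variables (A : superalgebra O) (d : nat).
Implicit Types (s t : tensor A d) (w u : word A d).

Definition mul_sgn (p q : 'I_d -> bool) : nat :=
  (\sum_(a < d) \sum_(c < d | a < c) p c * q a)%N.

Definition tmul s t : tensor A d :=
  \sum_w \sum_u ((s w : O) * (t u : O)) *:
    ((-1) ^+ mul_sgn (par \o w) (par \o u) *:
     pure (fun a => bas (w a) ** bas (u a))).

Definition tone : tensor A d := pure (fun=> sone).

Lemma tmul_linl t : linear (tmul^~ t).
Proof.
move=> c s s1; apply: sum_linear => w; apply: sum_linear => u.
by rewrite tensor_linE mulrDl scalerDl -mulrA; congr (_ + _); rewrite [RHS]scalerA.
Qed.

Lemma tmul_linr s : linear (tmul s).
Proof.
move=> c t t1; apply: sum_linear => w; apply: sum_linear => u.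
by rewrite tensor_linE mulrDr scalerDl mulrCA; congr (_ + _); rewrite [RHS]scalerA.
Qed.

Lemma tmul_pure (x y : 'I_d -> A) (p q : 'I_d -> bool) :
  (forall a, hom (p a) (x a)) -> (forall a, hom (q a) (y a)) ->
  tmul (pure x) (pure y) =
  (-1) ^+ mul_sgn p q *: pure (fun a => x a ** y a).
Proof.
move=> xp yq.
have mx (z : 'I_d -> A) : multilinear (fun x => pure (fun a => x a ** z a)).
  split=> [v v' eqv|a v c x1 x2].
    by apply: (pure_multilinear _ d).1 => a; rewrite eqv.
  have E (t : A) : pure (fun i => (if i == a then t else v i) ** z i) =
      pure (fun i => if i == a then t ** z a else v i ** z i).
    by apply: (pure_multilinear _ d).1 => i; case: eqP => [->|].
  by rewrite !E smul_linl (pure_multilinear _ d).2.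
have my (z : 'I_d -> A) : multilinear (fun x => pure (fun a => z a ** x a)).
  split=> [v v' eqv|a v c x1 x2].
    by apply: (pure_multilinear _ d).1 => a; rewrite eqv.
  have E (t : A) : pure (fun i => z i ** (if i == a then t else v i)) =
      pure (fun i => if i == a then z a ** t else z i ** v i).
    by apply: (pure_multilinear _ d).1 => i; case: eqP => [->|].
  by rewrite !E smul_linr (pure_multilinear _ d).2.
have nz (v : 'I_d -> A) (r : 'I_d -> bool) (w : word A d) :
    (forall a, hom (r a) (v a)) -> \prod_a dbas (w a) (v a) != 0 ->
    forall a, par (w a) = r a.
  move=> vr nz a; apply: dbas_hom (vr a) _; apply: contraNneq nz => z0.
  by rewrite (bigD1 a) //= z0 mul0r.
rewrite (multilinear_expand x (mx y)) scaler_sumr; apply: eq_bigr => w _.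
rewrite (multilinear_expand y (my _)) !scaler_sumr; apply: eq_bigr => u _.
rewrite !ffunE !scalerA.
have [-> | /(nz _ _ _ xp) wp] := eqVneq (\prod_a dbas (w a) (x a)) 0.
  by rewrite !(mul0r, mulr0).
have [-> | /(nz _ _ _ yq) uq] := eqVneq (\prod_a dbas (u a) (y a)) 0.
  by rewrite !(mul0r, mulr0).
rewrite mulrC; congr ((_ ^+ _ * _) *: _).
by apply: eq_bigr => a _; apply: eq_bigr => c _ /=; rewrite wp uq.
Qed.

Lemma bas_mul_hom w u a : hom (par (w a) (+) par (u a)) (bas (w a) ** bas (u a)).
Proof. by apply: smul_hom; apply: bas_hom. Qed.
Arguments bas_mul_hom : clear implicits.

Lemma mul_sgnDl p q r :
  odd (mul_sgn (fun a => p a (+) q a) r) = odd (mul_sgn p r) (+) odd (mul_sgn q r).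
Proof.
rewrite -oddD /mul_sgn -big_split /=.
apply: (big_ind2 (fun m n => odd m = odd n)) => [//|m m' n n'|a _].
  by rewrite !oddD => -> ->.
rewrite -big_split /=.
apply: (big_ind2 (fun m n => odd m = odd n)) => [//|m m' n n'|c _].
  by rewrite !oddD => -> ->.
by case: (p c) (q c) (r a) => [] [] [].
Qed.

Lemma mul_sgnDr p q r :
  odd (mul_sgn p (fun a => q a (+) r a)) = odd (mul_sgn p q) (+) odd (mul_sgn p r).
Proof.
rewrite -oddD /mul_sgn -big_split /=.
apply: (big_ind2 (fun m n => odd m = odd n)) => [//|m m' n n'|a _].
  by rewrite !oddD => -> ->.
rewrite -big_split /=.
apply: (big_ind2 (fun m n => odd m = odd n)) => [//|m m' n n'|c _].
  by rewrite !oddD => -> ->.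
by case: (p c) (q a) (r a) => [] [] [].
Qed.

Lemma tmulA : associative tmul.
Proof.
move=> x y z.
move: x; apply: tensor_linear_eq => [c x x'|c x x'|w].
- exact: tmul_linl.
- by rewrite !tmul_linl.
move: y; apply: tensor_linear_eq => [c x x'|c x x'|u].
- by rewrite tmul_linl tmul_linr.
- by rewrite tmul_linr tmul_linl.
move: z; apply: tensor_linear_eq => [c x x'|c x x'|v].
- by rewrite !tmul_linr.
- by rewrite tmul_linr.
have hb (w' : word A d) a : hom (par (w' a)) (bas (w' a)) by apply: bas_hom.
rewrite (tmul_pure (hb u) (hb v)) (tmul_pure (hb w) (hb u)).
have [_ _ -> _] := lin_props (tmul_linr (bast w)).
have [_ _ Z _] := lin_props (tmul_linl (bast v)); rewrite {}Z.
rewrite (tmul_pure (hb w) (bas_mul_hom u v)).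
rewrite (tmul_pure (bas_mul_hom w u) (hb v)).
rewrite !scalerA -!exprD; congr (_ *: _); last first.
  by apply: (pure_multilinear _ d).1 => a; rewrite smulA.
rewrite -[LHS]signr_odd -[RHS]signr_odd !oddD mul_sgnDl mul_sgnDr.
by congr (_ ^+ nat_of_bool _); do 4 case: (odd _).
Qed.

Lemma mul_sgn0l q : mul_sgn (fun=> false) q = 0%N.
Proof. by rewrite /mul_sgn big1 // => a _; rewrite big1. Qed.

Lemma mul_sgn0r p : mul_sgn p (fun=> false) = 0%N.
Proof.
by rewrite /mul_sgn big1 // => a _; rewrite big1 // => c _; rewrite muln0.
Qed.

Lemma tmul1l : left_id tone tmul.
Proof.
apply: tensor_linear_eq => [|//|w]; first exact: tmul_linr.
have hb a : hom (par (w a)) (bas (w a)) by apply: bas_hom.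
rewrite (tmul_pure (fun=> sone_hom A) hb) mul_sgn0l scale1r.
by apply: (pure_multilinear _ d).1 => a; rewrite smul1l.
Qed.

Lemma tmul1r : right_id tone tmul.
Proof.
apply: tensor_linear_eq => [|//|w]; first exact: tmul_linl.
have hb a : hom (par (w a)) (bas (w a)) by apply: bas_hom.
rewrite (tmul_pure hb (fun=> sone_hom A)) mul_sgn0r scale1r.
by apply: (pure_multilinear _ d).1 => a; rewrite smul1r.
Qed.

Lemma pure_par (x : 'I_d -> A) (p : 'I_d -> bool) (w : word A d) :
  (forall a, hom (p a) (x a)) -> pure x w != 0 -> parw w = odd (\sum_a p a)%N.
Proof.
move=> xp; rewrite ffunE => nz; congr (odd _); apply: eq_bigr => a _.
congr (nat_of_bool _); apply: dbas_hom (xp a) _; apply: contraNneq nz => z0.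
by rewrite (bigD1 a) //= z0 mul0r.
Qed.

Lemma tone_hom : hom (V := tensor_smod A d) false tone.
Proof.
move=> w /= ne; rewrite dbastE; apply/eqP; apply: contraNT ne => nz.
by rewrite (pure_par (fun=> sone_hom A) nz) big1.
Qed.

Lemma tmul_hom e f s t :
  hom (V := tensor_smod A d) e s -> hom (V := tensor_smod A d) f t ->
  hom (V := tensor_smod A d) (e (+) f) (tmul s t).
Proof.
move=> hs ht w /= ne; rewrite dbastE sum_ffunE big1 // => u _.
rewrite sum_ffunE big1 // => v _.
have Z c (x : tensor A d) : (c *: x) w = c * x w by rewrite ffunE.
rewrite !Z.
have [ue|/hs] := eqVneq (parw u) e; last by rewrite /= dbastE => ->; rewrite !mul0r.
have [vf|/ht] := eqVneq (parw v) f; last first.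
  by rewrite /= dbastE => ->; rewrite mulr0 mul0r.
suff -> : pure (fun a => bas (u a) ** bas (v a)) w = 0 by rewrite !mulr0.
apply/eqP; apply: contraNT ne => nz; rewrite (pure_par (bas_mul_hom u v) nz).
rewrite -ue -vf /parw -oddD -big_split /=; apply/eqP.
apply: (big_ind2 (fun m n => odd m = odd n)) => [//|m m' n n'|c _].
  by rewrite !oddD => -> ->.
by case: (par (u c)) (par (v c)) => [] [].
Qed.

Definition tensor_alg : superalgebra O :=
  Superalgebra (salg_smod := tensor_smod A d)
    tmulA tmul1l tmul1r tmul_linl tmul_linr tone_hom tmul_hom.

End Salg.
End TensorAlgebra.
Arguments bas_hom {O V} i.

Section TrivialExtension.
Variables (O : comNzRingType) (X : superalgebra O).

Definition dual := 'Hom(X, O^o).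

(* The pairing of X with X^* in either order is <al, b> = <b, al> = al b,
   without sign. *)
Definition dual_act (al : dual) (a : X) : dual := linfun (fun b => al (a ** b)).
Definition act_dual (a : X) (al : dual) : dual := linfun (fun b => al (b ** a)).

Lemma dual_actE al a b : dual_act al a b = al (a ** b).
Proof. by apply: linfunE => c x y; rewrite smul_linr linearP. Qed.

Lemma act_dualE al a b : act_dual a al b = al (b ** a).
Proof. by apply: linfunE => c x y; rewrite smul_linl linearP. Qed.

Definition T_sort := (X * dual)%type.
Definition T_par (i : idx X + idx X) : bool :=
  match i with inl j => par j | inr j => par j end.
Definition T_bas (i : idx X + idx X) : T_sort :=
  match i with inl j => (bas j, 0) | inr j => (0, dbas j) end.
Definition T_dbas (i : idx X + idx X) : 'Hom(T_sort, O^o) :=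
  match i with
  | inl j => linfun (fun x : T_sort => dbas j x.1)
  | inr j => linfun (fun x : T_sort => x.2 (bas j))
  end.

Lemma T_dbasE i x :
  T_dbas i x = match i with inl j => dbas j x.1 | inr j => x.2 (bas j) end.
Proof.
case: i => j; apply: (linfunE _ x) => c y z /=; first exact: linearP.
by rewrite add_lfunE scale_lfunE.
Qed.

Lemma T_dbas_bas i j : T_dbas i (T_bas j) = (i == j)%:R.
Proof.
rewrite T_dbasE; case: i j => [i|i] [j|j] /=; rewrite ?dbas_bas ?linear0 //.
  by rewrite zero_lfunE.
by rewrite eq_sym.
Qed.

Lemma dual_sum (al : dual) : al = \sum_i al (bas i) *: dbas i.
Proof.
apply/lfunP => v; rewrite {1}(bas_sum v) linear_sum sum_lfunE.
by apply: eq_bigr => i _; rewrite linearZ scale_lfunE; apply: mulrC.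
Qed.

Lemma T_bas_sum x : x = \sum_i T_dbas i x *: T_bas i.
Proof.
rewrite big_sumType; under eq_bigr do rewrite T_dbasE.
under [X in _ = _ + X]eq_bigr do rewrite T_dbasE.
have -> : \sum_i dbas i x.1 *: T_bas (inl i) = (x.1, 0).
  rewrite {2}(bas_sum x.1) (big_morph (fun a : X => (a, 0) : T_sort)
    (id1 := 0) (op1 := +%R)) => [|a b|//]; last by congr (_, _); rewrite addr0.
  by apply: eq_bigr => i _; congr (_, _); rewrite scaler0.
have -> : \sum_i x.2 (bas i) *: T_bas (inr i) = (0, x.2).
  rewrite {2}(dual_sum x.2) (big_morph (fun a : dual => (0, a) : T_sort)
    (id1 := 0) (op1 := +%R)) => [|a b|//]; last by congr (_, _); rewrite addr0.
  by apply: eq_bigr => i _; congr (_, _); rewrite scaler0.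
by case: x => a al; congr (_, _); rewrite /= ?addr0 ?add0r.
Qed.

Definition T_smod : supermodule O := Supermodule T_par T_dbas_bas T_bas_sum.

Definition T_mul (x y : T_smod) : T_smod :=
  (x.1 ** y.1, act_dual x.1 y.2 + dual_act x.2 y.1).
Definition T_one : T_smod := (sone, 0).

Lemma T_mulA : associative T_mul.
Proof.
move=> [a al] [b be] [c ga]; congr (_, _); rewrite /= ?smulA //.
apply/lfunP => v.
rewrite !add_lfunE !(act_dualE, dual_actE) !add_lfunE !(act_dualE, dual_actE).
by rewrite !smulA addrA.
Qed.

Lemma T_mul1l : left_id T_one T_mul.
Proof.
move=> [a al]; congr (_, _); rewrite /= ?smul1l //; apply/lfunP => v.
by rewrite add_lfunE act_dualE dual_actE zero_lfunE smul1r addr0.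
Qed.

Lemma T_mul1r : right_id T_one T_mul.
Proof.
move=> [a al]; congr (_, _); rewrite /= ?smul1r //; apply/lfunP => v.
by rewrite add_lfunE act_dualE dual_actE zero_lfunE smul1l add0r.
Qed.

Lemma T_mul_linl y : linear (T_mul^~ y).
Proof.
case: y => b be c [a al] [a' al']; congr (_, _) => /=; first exact: smul_linl.
apply/lfunP => v.
rewrite !(add_lfunE, scale_lfunE, act_dualE, dual_actE) smul_linr linearP.
by rewrite scalerDr addrACA.
Qed.

Lemma T_mul_linr x : linear (T_mul x).
Proof.
case: x => b be c [a al] [a' al']; congr (_, _) => /=; first exact: smul_linr.
apply/lfunP => v.
rewrite !(add_lfunE, scale_lfunE, act_dualE, dual_actE) smul_linl linearP.
by rewrite scalerDr addrACA.
Qed.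

Lemma T_hom e (x : T_smod) :
  hom e x <-> hom e x.1 /\ forall i, par i != e -> x.2 (bas i) = 0.
Proof.
split=> [h|[h1 h2] i ne]; last first.
  by rewrite [LHS](T_dbasE i x); case: i ne => i; [apply: h1 | apply: h2].
by split=> i ne; [have := h (inl i) ne | have := h (inr i) ne];
  rewrite [X in X = _ -> _](T_dbasE _ x).
Qed.

Lemma hom_eval (al : dual) e f (v : X) :
  (forall i, par i != e -> al (bas i) = 0) -> hom f v -> e != f -> al v = 0.
Proof.
move=> hal hv nef; rewrite [v]bas_sum linear_sum big1 // => i _; rewrite linearZ /=.
have [pe|/hal ->] := eqVneq (par i) e; last by rewrite scaler0.
by rewrite hv ?scale0r // pe.
Qed.

Lemma T_one_hom : hom false T_one.
Proof.
by apply/T_hom; split=> [|i _]; [exact: sone_hom | rewrite zero_lfunE].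
Qed.

Lemma T_mul_hom e f x y : hom e x -> hom f y -> hom (e (+) f) (T_mul x y).
Proof.
move=> /T_hom[x1 x2] /T_hom[y1 y2]; apply/T_hom; split; first exact: smul_hom.
move=> i ne; rewrite /= add_lfunE act_dualE dual_actE.
rewrite (hom_eval y2 (smul_hom (bas_hom i) x1)).
  rewrite (hom_eval x2 (smul_hom y1 (bas_hom i))) ?addr0 //.
  by move: ne; case: e f (par i) {x1 x2 y1 y2} => [] [] [].
by move: ne; case: e f (par i) {x1 x2 y1 y2} => [] [] [].
Qed.

Definition T_alg : superalgebra O :=
  Superalgebra (salg_smod := T_smod)
    T_mulA T_mul1l T_mul1r T_mul_linl T_mul_linr T_one_hom T_mul_hom.

Definition in_X (x : T_alg) : Prop := x.2 = 0.
Definition in_X0 (x : T_alg) : Prop := hom false x.1 /\ x.2 = 0.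
Definition in_dual (x : T_alg) : Prop := x.1 = 0.
Definition in_Y (x : T_alg) : Prop := hom true x.1.

(* The span of the xi * x_1 * ... * x_e, for xi in Inv^{d-e} X and x_i in X^*:
   the sum over e of the Inv^{d-e} X * Star^e(X^* ). *)
Definition turner_double d : tensor T_alg d -> Prop :=
  lspan (fun t => exists (e : nat) (le_ed : (e <= d)%N)
                        (p : tensor T_alg (d - e)) (q : tensor T_alg e),
    [/\ Inv in_X p, Star in_dual q & t = tcast (subnK le_ed) (shuffle p q)]).

Definition generators d (d_gt0 : (0 < d)%N) (t : tensor T_alg d) : Prop :=
  Inv in_X0 t \/
  exists2 y : T_alg, in_Y y &
    t = tcast (subnK d_gt0)
          (shuffle (pure (fun _ : 'I_(d - 1) => sone)) (pure (fun _ : 'I_1 => y))).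

End TrivialExtension.

(* Main.v *)
From mathcomp Require Import all_boot all_order all_fingroup all_algebra.
Require Import Defs.

(** Write T for the trivial extension of X and call the basis elements of T
letters. A letter is either a letter of X or one of X^*; those outside X_0 span
the module Y.

The proof replaces shuffles by induction of invariants. If a tensor s is fixed
by a subgroup H of the symmetric group, then [ind H s t] says that t is the sum
of s over the cosets of H, in the division-free form
#|H| t = (sum of all translates of s). As O is a domain of characteristic zero,
tensors have no torsion: t is determined by s, and an identity between such
tensors may be checked after multiplication by group orders. The shuffle of an
invariant p in degree m with v_1 * ... * v_e is induced in this way from the
tensor p (x) v_1 (x) ... (x) v_e, which is fixed by S_m
([shuffle_fixed_sym], [star_sym]). The gain is that the positions may be treated
as a set without order: for a set L of letters, [induced L] is the span of the
tensors induced from some s which has letters of L in a set J of positions and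
is fixed by a group H of permutations of J.

Three facts give the theorem.

- The Turner double is [induced L] for L the letters of X ([turner_induced],
  [induced_turner]). Positions outside J may a priori carry letters of X as
  well, but such a position can be added to J by induction in stages
  ([ind_trans]).

- Odd letters can be dropped from L ([induced_pull]). An odd letter cannot
  occur twice in the positions of J, because 2 is not zero in O; and if it
  occurs once, its position is moved by H, so that Mackey's formula
  ([ind_Mackey]) rewrites the induced tensor with that position taken out of J.
  Hence the Turner double is [induced L0] for L0 the letters of X_0.

- [induced L0] is the subalgebra generated by Inv^d X_0 and the elements
  1^(d-1) * y. The element 1^(d-1) * y is the sum, over all positions, of y
  placed there with 1 elsewhere ([spread_shuffle]). By Mackey's formula, its
  product with a tensor induced from (H, s) is the sum, over the orbits of H on
  positions, of the tensor induced from the stabilizer of a position b in the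
  orbit and from y placed at b times s. This shows that [induced L0] is stable
  under left multiplication by the generators ([induced_spread_tmul]), hence
  contains what they generate. Conversely ([induced_sub_closed]), a tensor
  induced from s is reached by induction on the number of positions outside J.
  Pick such a position a; one may assume that s carries a fixed letter y
  there, with y in Y, as otherwise a can be added to J. Replace y by 1. The
  result is reached by the induction hypothesis, and its product with
  1^(d-1) * y contains the wanted tensor: it is the term where y comes back to
  its place. The terms where y falls on another position outside J again have
  fewer positions outside. To control those where y falls into J, J is divided
  into a set K with arbitrary letters of X_0 and a set M where s carries 1: in
  these terms a position of K has left K, so a second induction, on the size of
  K, applies. *)

Set Implicit Arguments.
Unset Strict Implicit.
Unset Printing Implicit Defensive.

Import GRing.Theory.
Local Open Scope ring_scope.

(** * Signs of the permutation action *)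

Section Signs.
Variables (O : comNzRingType) (d : nat).
Implicit Types (g h : 'S_d) (p q : 'I_d -> bool).

Lemma ord_ltnNge (a c : 'I_d) : a != c -> (a < c)%N = ~~ (c < a)%N.
Proof.
move=> ne; rewrite -leqNgt [RHS]leq_eqVlt.
by have -> : (a == c :> nat) = false by exact: negPf ne.
Qed.

(** A pair a < c whose order is reversed by the inverse of g is met as (c, a)
after reindexing along g. Each sign identity below is this lemma followed by a
check of the pairs one by one. *)
Lemma prod_pairs_perm (F : 'I_d -> 'I_d -> O) g :
  \prod_(a < d) \prod_(c < d | (a < c)%N) F (g a) (g c) =
  \prod_(a < d) \prod_(c < d | (a < c)%N)
    (if (g^-1%g c < g^-1%g a)%N then F c a else F a c).
Proof.
rewrite pair_big_dep [RHS]pair_big_dep /=.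
rewrite (reindex (fun x : 'I_d * 'I_d => (g^-1%g x.1, g^-1%g x.2))) /=; last first.
  by exists (fun x => (g x.1, g x.2)) => [[a c] _|[a c] _] /=; rewrite ?permK ?permKV.
under eq_bigr do rewrite !permKV.
rewrite (bigID (fun x : 'I_d * 'I_d => x.1 < x.2)%N) [RHS](bigID
  (fun x : 'I_d * 'I_d => g^-1%g x.1 < g^-1%g x.2)%N) /=; congr (_ * _).
  apply: eq_big => [[a c]|[a c] /andP[lt_g lt_ac]] /=; first by rewrite andbC.
  by rewrite ltnNge ltnW.
rewrite (reindex (fun x : 'I_d * 'I_d => (x.2, x.1))) /=; last first.
  by exists (fun x => (x.2, x.1)) => [[a c] _|[a c] _].
apply: eq_big => [[a c]|[a c] /andP[lt_g lt_ac]] /=; last by rewrite lt_g.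
have [-> | ne] := eqVneq a c; first by rewrite !ltnn.
have ne' : g^-1%g c != g^-1%g a by rewrite (inj_eq perm_inj) eq_sym.
by rewrite (ord_ltnNge ne) (ord_ltnNge ne') andbC.
Qed.

Definition actsgn g p : O := (-1) ^+ act_sgn g p.
Definition mulsgn p q : O := (-1) ^+ mul_sgn p q.

Lemma actsgnE g p : actsgn g p =
  \prod_(a < d) \prod_(c < d | (a < c)%N)
    (-1) ^+ [&& (g^-1%g c < g^-1%g a)%N, p a & p c].
Proof.
rewrite /actsgn /act_sgn expr_sum; apply: eq_bigr => a _.
rewrite expr_sum big_mkcondr; apply: eq_bigr => c _.
by case: ifP => //=; case: (p a); case: (p c).
Qed.

Lemma mulsgnE p q : mulsgn p q =
  \prod_(a < d) \prod_(c < d | (a < c)%N) (-1) ^+ (p c && q a).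
Proof.
rewrite /mulsgn /mul_sgn expr_sum; apply: eq_bigr => a _.
by rewrite expr_sum; apply: eq_bigr => c _; case: (p c); case: (q a).
Qed.

Lemma actsgn_ext g p q : p =1 q -> actsgn g p = actsgn g q.
Proof.
by move=> pq; rewrite !actsgnE; apply: eq_bigr => a _; apply: eq_bigr => c _; rewrite !pq.
Qed.

Lemma mulsgn_ext p q p' q' : p =1 p' -> q =1 q' -> mulsgn p q = mulsgn p' q'.
Proof.
move=> pp qq; rewrite !mulsgnE; apply: eq_bigr => a _; apply: eq_bigr => c _.
by rewrite pp qq.
Qed.

Lemma lt_neq (a c : 'I_d) : (a < c)%N -> a != c.
Proof. by rewrite neq_ltn => ->. Qed.

(** The cocycle identity behind [tactM]: the composite reverses a pair when
exactly one of the two steps does. *)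
Lemma actsgnM g h p :
  actsgn (h * g)%g p = actsgn g p * actsgn h (p \o g).
Proof.
rewrite [actsgn h _]actsgnE.
have := prod_pairs_perm (fun a c => (-1) ^+
  [&& ((h * g)^-1%g c < (h * g)^-1%g a)%N, p a & p c]) g.
under eq_bigr do under eq_bigr do rewrite !invMg !permM !permK.
move=> ->; rewrite !actsgnE -big_split; apply: eq_bigr => a _ /=.
rewrite -big_split; apply: eq_bigr => c /lt_neq ne /=.
rewrite [((h * g)^-1%g a < _)%N]ord_ltnNge ?(inj_eq perm_inj) // andbCA andbC -andbA.
by case: ifP => _; case: (_ < _)%N; case: (p a); case: (p c);
  rewrite /= ?expr1 ?expr0 ?(mulN1r, mul1r, mulr1, opprK).
Qed.

(** The identity behind [tact_tmul]: the pairs in which the parities of p and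
q have to be exchanged after the action of g are those that g reverses. *)
Lemma actsgn_addb g p q :
  actsgn g (fun a => p a (+) q a) * mulsgn p q =
  actsgn g p * actsgn g q * mulsgn (p \o g) (q \o g).
Proof.
rewrite (mulsgnE (p \o g)) /=.
have /= -> := prod_pairs_perm (fun a c => (-1) ^+ (p c && q a)) g.
rewrite !actsgnE mulsgnE.
rewrite -!big_split; apply: eq_bigr => a _ /=.
rewrite -!big_split; apply: eq_bigr => c _ /=.
by case: (_ < _)%N; case: (p a); case: (p c); case: (q a); case: (q c);
  rewrite /= ?expr1 ?expr0 ?(mulN1r, mul1r, mulr1, opprK).
Qed.

(** Only odd letters that pass each other contribute to the sign. *)
Lemma actsgn_even g p (J : {set 'I_d}) :
  {in J, p =1 xpred0} -> perm_on J g -> actsgn g p = 1.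
Proof.
move=> pJ gJ; rewrite actsgnE big1 // => a _; rewrite big1 // => c lt_ac.
have [aJ|aJ] := boolP (a \in J); first by rewrite (pJ a aJ) andbF.
have [cJ|cJ] := boolP (c \in J); first by rewrite (pJ c cJ) !andbF.
by rewrite !(out_perm (perm_onV gJ)) // ltnNge ltnW.
Qed.

Lemma actsgn_single g (b : 'I_d) (e : bool) : actsgn g (fun a => (a == b) && e) = 1.
Proof.
rewrite actsgnE big1 // => a _; rewrite big1 // => c /lt_neq ne_ac.
have [ab|_] := eqVneq a b; last by rewrite andbF.
by rewrite -ab [c == a]eq_sym (negPf ne_ac) !andbF.
Qed.

(** The odd letters between a and c are passed twice and contribute nothing:
[actsgn_addb] splits the parities into those at a and c, which give the sign,
and the others, on which [actsgn_even] applies. *)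
Lemma actsgn_tperm (a c : 'I_d) p : a != c -> p a -> p c ->
  actsgn (tperm a c) p = -1.
Proof.
wlog lt_ac : a c / (a < c)%N => [H ne pa pc|ne pa pc].
  have := ne; rewrite neq_ltn => /orP[lt|lt]; first exact: H.
  by rewrite tpermC; apply: H => //; rewrite eq_sym.
pose q x := (x == a) || (x == c); pose r x := p x (+) q x.
have pE : p =1 (fun x => r x (+) q x) by move=> x; rewrite /r -addbA addbb addbF.
have tE (x : 'I_d) (s : 'I_d -> bool) : s a = s c -> s (tperm a c x) = s x.
  by move=> sE; case: tpermP => [->|->|].
have qac : q a = q c by rewrite /q !eqxx orbT.
have rac : r a = r c by rewrite /r pa pc qac.
have := actsgn_addb (tperm a c) r q.
rewrite -(actsgn_ext _ pE) (@actsgn_even _ r [set a; c]); last exact: tperm_on.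
  rewrite mul1r (mulsgn_ext (p' := r) (q' := q)); last 2 first.
  - by move=> x; apply: tE.
  - by move=> x; apply: tE.
  have M1 : mulsgn r q * mulsgn r q = 1 by rewrite -expr2 sqrr_sign.
  move/(congr1 ( *%R^~ (mulsgn r q))); rewrite -!mulrA M1 !mulr1 => ->.
  rewrite actsgnE (bigD1 a) //= (bigD1 c) //= tpermV tpermL tpermR lt_ac /q !eqxx orbT.
  rewrite expr1 [X in _ * X]big1 ?mulr1 => [|x ne_xa].
    rewrite big1 ?mulr1 // => x /andP[lt_ax ne_xc].
    by rewrite [x == a]eq_sym (negPf (lt_neq lt_ax)) (negPf ne_xc) !andbF.
  rewrite big1 // => y lt_xy; rewrite (negPf ne_xa) /=.
  have [xc|] := eqVneq x c; last by rewrite andbF.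
  rewrite xc in lt_xy *; rewrite [y == c]eq_sym (negPf (lt_neq lt_xy)).
  have [ya|] := eqVneq y a; last by rewrite !andbF.
  by move: lt_xy; rewrite ya ltnNge ltnW.
by move=> x /set2P[]->; rewrite /r ?pa ?pc /q !eqxx ?orbT.
Qed.

End Signs.

Arguments actsgn O {d} g p.
Arguments mulsgn O {d} p q.

(** * Submodules, the action on tensors, and tensors with prescribed slots *)

Section Submodules.
Variables (O : comNzRingType) (V : lmodType O).
Implicit Types (S P : V -> Prop).

Definition submodule P := P 0 /\ forall c x y, P x -> P y -> P (c *: x + y).

Lemma submodD P x y : submodule P -> P x -> P y -> P (x + y).
Proof. by move=> [_ lP] Px Py; rewrite -[x]scale1r; apply: lP. Qed.

Lemma submodZ P c x : submodule P -> P x -> P (c *: x).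
Proof. by move=> [P0 lP] Px; rewrite -[_ *: _]addr0; apply: lP. Qed.

Lemma submodB P x y : submodule P -> P x -> P y -> P (x - y).
Proof. by move=> sP Px Py; apply: submodD => //; rewrite -scaleN1r; apply: submodZ. Qed.

Lemma submod_sum P (I : Type) (r : seq I) (Q : pred I) F :
  submodule P -> (forall i, Q i -> P (F i)) -> P (\sum_(i <- r | Q i) F i).
Proof.
by move=> sP PF; apply: big_ind => //; [exact: sP.1 | move=> *; apply: submodD].
Qed.

Lemma lspan_gen S x : S x -> lspan S x.
Proof.
move=> Sx; exists 1%N, (fun=> 1), (fun=> x); split=> //.
by rewrite big_ord1 scale1r.
Qed.

Lemma lspan_submod S : submodule (lspan S).
Proof.
split; first by exists 0%N, (fun=> 0), (fun=> 0); split=> [[]//|]; rewrite big_ord0.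
move=> c _ _ [m [a [s [Ss ->]]]] [n [b [t [St ->]]]].
exists (m + n)%N, (fun i => match split i with inl j => c * a j | inr j => b j end),
  (fun i => match split i with inl j => s j | inr j => t j end).
split=> [i|]; first by case: (split i).
rewrite big_split_ord /= scaler_sumr; congr (_ + _); apply: eq_bigr => i _.
  by have /= -> := unsplitK (inl i : 'I_m + 'I_n); rewrite scalerA.
by have /= -> := unsplitK (inr i : 'I_m + 'I_n).
Qed.

Lemma lspan_ind S P : submodule P -> (forall x, S x -> P x) ->
  forall x, lspan S x -> P x.
Proof.
move=> sP SP _ [n [c [s [Ss ->]]]].
by apply: submod_sum => // i _; apply: submodZ => //; apply: SP.
Qed.

End Submodules.

Lemma submod_preim (O : comNzRingType) (V W : lmodType O) (f : V -> W) (P : W -> Prop) :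
  linear f -> submodule P -> submodule (P \o f).
Proof.
move=> lf sP; have [f0 _ _ _] := lin_props lf; split=> [|c x y Px Py] /=.
  by rewrite f0; exact: sP.1.
by rewrite lf; apply: sP.2.
Qed.

Lemma submod_eq (O : comNzRingType) (V W : lmodType O) (f g : V -> W) :
  linear f -> linear g -> submodule (fun x => f x = g x).
Proof.
move=> lf lg; have [f0 _ _ _] := lin_props lf; have [g0 _ _ _] := lin_props lg.
by split=> [|c x y Ex Ey]; rewrite ?f0 ?g0 // lf lg Ex Ey.
Qed.

Section Action.
Variables (O : comNzRingType) (V : supermodule O) (d : nat).
Implicit Types (s t : tensor V d) (w : word V d) (g h : 'S_d).

Lemma tensorZE c t w : (c *: t) w = c * (t w : O) :> O.
Proof. by rewrite ffunE. Qed.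

Lemma tensorDE s t w : (s + t) w = (s w : O) + (t w : O) :> O.
Proof. by rewrite ffunE. Qed.

Definition wperm w g : word V d := [ffun a => w (g a)].

Lemma wpermM w g h : wperm (wperm w g) h = wperm w (h * g).
Proof. by apply/ffunP => a; rewrite !ffunE permM. Qed.

Lemma wperm1 w : wperm w 1 = w.
Proof. by apply/ffunP => a; rewrite ffunE perm1. Qed.

Lemma tact_linear g : linear (@tact O V d ^~ g).
Proof.
move=> c s t; apply: sum_linear => w.
by rewrite tensor_linE scalerDl; congr (_ + _); rewrite [RHS]scalerA.
Qed.

Lemma bast_wperm w g : pure (fun a => bas (w (g a))) = bast (wperm w g).
Proof. by apply: (pure_multilinear V d).1 => a; rewrite ffunE. Qed.

Lemma tact_pure_hom (v : 'I_d -> V) (p : 'I_d -> bool) g :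
  (forall a, hom (p a) (v a)) ->
  tact (pure v) g = actsgn O g p *: pure (fun a => v (g a)).
Proof. exact: tact_pure. Qed.

Lemma tact_bast w g : tact (bast w) g = actsgn O g (par \o w) *: bast (wperm w g).
Proof. by rewrite -bast_wperm; apply: tact_pure_hom => a; apply: bas_hom. Qed.

Lemma tactE t g w : tact t g w =
  actsgn O g (par \o wperm w g^-1) * (t (wperm w g^-1) : O) :> O.
Proof.
rewrite /tact sum_ffunE (bigD1 (wperm w g^-1)) //= big1 => [|u ne].
  rewrite addr0 bast_wperm wpermM mulgV wperm1 !tensorZE bastE eqxx mulr1.
  by rewrite mulrC.
rewrite bast_wperm !tensorZE bastE; case: eqP => [E|]; last by rewrite !mulr0.
by case/eqP: ne; rewrite E wpermM mulVg wperm1.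
Qed.

Lemma tactM t g h : tact (tact t g) h = tact t (h * g)%g.
Proof.
move: t; apply: tensor_linear_eq => [c s t|c s t|w]; rewrite ?tact_linear //.
rewrite tact_bast; have [_ _ -> _] := lin_props (tact_linear h).
rewrite !tact_bast scalerA actsgnM wpermM; congr (_ * _ *: _).
by apply: actsgn_ext => a; rewrite /= ffunE.
Qed.

Lemma tact1 t : tact t 1 = t.
Proof.
move: t; apply: tensor_linear_eq => [c s t|//|w]; rewrite ?tact_linear //.
rewrite tact_bast wperm1 (@actsgn_even _ _ _ _ set0) ?scale1r ?perm_on1 //.
by move=> a; rewrite inE.
Qed.

Lemma tact0 g : tact (0 : tensor V d) g = 0.
Proof. by have [] := lin_props (tact_linear g). Qed.
Lemma tactZ c t g : tact (c *: t) g = c *: tact t g.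
Proof. by have [] := lin_props (tact_linear g). Qed.
Lemma tact_sum (I : Type) (r : seq I) (P : pred I) (F : I -> tensor V d) g :
  tact (\sum_(i <- r | P i) F i) g = \sum_(i <- r | P i) tact (F i) g.
Proof. by have [] := lin_props (tact_linear g). Qed.

Definition sym t := \sum_(g : 'S_d) tact t g.

Lemma sym_linear : linear sym.
Proof. by move=> c s t; apply: sum_linear => g; apply: tact_linear. Qed.

Lemma symD s t : sym (s + t) = sym s + sym t.
Proof. by have [] := lin_props sym_linear. Qed.
Lemma symZ c t : sym (c *: t) = c *: sym t.
Proof. by have [] := lin_props sym_linear. Qed.
Lemma sym_sum (I : Type) (r : seq I) (P : pred I) (F : I -> tensor V d) :
  sym (\sum_(i <- r | P i) F i) = \sum_(i <- r | P i) sym (F i).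
Proof. by have [] := lin_props sym_linear. Qed.

Lemma sym_tact t g : sym (tact t g) = sym t.
Proof.
rewrite /sym [RHS](reindex_inj (mulIg g)).
by apply: eq_bigr => h _; rewrite tactM.
Qed.

Lemma tact_sym t g : tact (sym t) g = sym t.
Proof.
rewrite tact_sum [RHS](reindex_inj (mulgI g)).
by apply: eq_bigr => h _; rewrite tactM.
Qed.

Definition fixed (H : {set 'S_d}) t := forall g, g \in H -> tact t g = t.

Lemma fixed_submod H : submodule (fixed H).
Proof.
split=> [g _|c x y fx fy g gH]; first exact: tact0.
by rewrite tact_linear fx ?fy.
Qed.

Lemma fixed_sub (H G : {set 'S_d}) t : H \subset G -> fixed G t -> fixed H t.
Proof. by move=> /subsetP sHG fG g /sHG; apply: fG. Qed.

(** The entries of the pure tensors are required to be homogeneous because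
[tact] and [tmul] have a simple form on such tensors only. *)
Definition slots (Q : 'I_d -> V -> Prop) : tensor V d -> Prop :=
  lspan (fun t => exists v p,
    (forall a, hom (p a) (v a) /\ Q a (v a)) /\ t = pure v).

Lemma slots_submod Q : submodule (slots Q).
Proof. exact: lspan_submod. Qed.

Lemma slots_pure (Q : 'I_d -> V -> Prop) v p :
  (forall a, hom (p a) (v a)) -> (forall a, Q a (v a)) -> slots Q (pure v).
Proof. by move=> hv Qv; apply: lspan_gen; exists v, p; split. Qed.

Lemma slots_sub (Q Q' : 'I_d -> V -> Prop) t :
  (forall a x, Q a x -> Q' a x) -> slots Q t -> slots Q' t.
Proof.
move=> QQ; apply: lspan_ind; first exact: slots_submod.
move=> _ [v [p [vP ->]]]; apply: (@slots_pure _ _ p) => a; case: (vP a) => //.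
by move=> _ /QQ.
Qed.

Definition lets (L : {set idx V}) (x : V) := forall i, i \notin L -> dbas i x = 0.

Lemma lets_bas (L : {set idx V}) i : i \in L -> lets L (bas i).
Proof.
move=> iL j jL; rewrite dbas_bas; case: eqVneq => // ji.
by rewrite ji iL in jL.
Qed.

(** Unlike general conditions on the entries, those given by sets of letters
can be read off the coefficients, and so hold for any part of a tensor obtained
by restriction to some words. *)
Lemma slots_letsP (L : 'I_d -> {set idx V}) t :
  slots (fun a => lets (L a)) t <-> (forall w, t w != 0 -> forall a, w a \in L a).
Proof.
split.
  move=> tL w; move: t tL.
  apply: lspan_ind; first split.
  - by rewrite ffunE eqxx.
  - move=> c x y Px Py nz a; apply: contraTT nz => waL; rewrite negbK tensor_linE.
    have -> : x w = 0 by apply/eqP; apply: contraNT waL => /Px; apply.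
    have -> : y w = 0 by apply/eqP; apply: contraNT waL => /Py; apply.
    by rewrite mulr0 addr0.
  move=> _ [v [p [vP ->]]]; rewrite ffunE => nz a; apply: contraNT nz => waL.
  by rewrite (bigD1 a) //= (vP a).2 // mul0r.
move=> tL; rewrite [t]tensor_sum; apply: submod_sum => [|w _]; first exact: slots_submod.
have [->|nz] := eqVneq (t w) 0; first by rewrite scale0r; apply: (slots_submod _).1.
apply: submodZ; first exact: slots_submod.
apply: (@slots_pure _ _ (par \o w)) => a; first exact: bas_hom.
exact/lets_bas/tL.
Qed.

Lemma slots_tact (Q Q' : 'I_d -> V -> Prop) t g :
  (forall a x, Q (g a) x -> Q' a x) -> slots Q t -> slots Q' (tact t g).
Proof.
move=> Qg; apply: (lspan_ind (P := fun t => slots Q' (tact t g))).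
  exact: (submod_preim (tact_linear g) (slots_submod Q')).
move=> _ [v [p [vP ->]]]; rewrite (tact_pure_hom g (fun a => (vP a).1)).
apply: submodZ; first exact: slots_submod.
apply: (@slots_pure _ _ (p \o g)) => a; first exact: (vP _).1.
exact/Qg/(vP _).2.
Qed.

End Action.

Arguments fixed {O V d} H t.

(** * Induction of invariant tensors and Mackey's formula *)

Section Induction.
Variables (O : idomainType) (V : supermodule O) (d : nat).
Hypothesis charO : forall n, (0 < n)%N -> n%:R != 0 :> O.
Implicit Types (s t : tensor V d) (H G : {group 'S_d}).

Lemma tensor_scaleI n s t : (0 < n)%N -> n%:R *: s = n%:R *: t -> s = t.
Proof.
move=> n0 st; apply/ffunP => w; have /ffunP/(_ w) := st.
by rewrite !tensorZE => /(mulfI (charO n0)).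
Qed.

(** The tensor t is the sum of s over the cosets of H; stated in this form, no
coset representatives have to be chosen. *)
Definition ind H s t := fixed H s /\ #|H|%:R *: t = sym s.

Lemma ind_uniq H s t t' : ind H s t -> ind H s t' -> t = t'.
Proof. by move=> [_ E] [_ E']; apply: (tensor_scaleI (cardG_gt0 H)); rewrite E E'. Qed.

Lemma ind_setT t : fixed setT t -> ind [set: 'S_d]%G t t.
Proof.
move=> ft; split=> //; rewrite /sym (eq_bigr (fun=> t)) => [|g _].
  by rewrite sumr_const scaler_nat cardsT.
by rewrite ft ?inE.
Qed.

Lemma ind_add H s t s' t' :
  ind H s t -> ind H s' t' -> ind H (s + s') (t + t').
Proof.
move=> [fs E] [fs' E']; split; first exact: (submodD (@fixed_submod _ _ _ H) fs fs').
by rewrite scalerDr E E' symD.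
Qed.

Lemma ind_sum (I : finType) H (s t : I -> tensor V d) :
  (forall i, ind H (s i) (t i)) -> ind H (\sum_i s i) (\sum_i t i).
Proof.
move=> st; split.
  by apply: submod_sum => [|i _]; [exact: fixed_submod | exact: (st i).1].
by rewrite scaler_sumr sym_sum; apply: eq_bigr => i _; exact: (st i).2.
Qed.

(** Translates of s depend only on the coset, so their sum over G is divisible
by the order of H. The last clause serves to carry over to s' the conditions on
the entries of s. *)
Lemma coset_sum H G s : H \subset G -> fixed H s ->
  exists s', [/\ #|H|%:R *: s' = \sum_(g in G) tact s g, fixed G s'
    & forall P, submodule P -> (forall g, g \in G -> P (tact s g)) -> P s'].
Proof.
move=> sHG fs; pose s' := \sum_(C in lcosets H G) tact s (repr C).
have E : #|H|%:R *: s' = \sum_(g in G) tact s g.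
  rewrite (partition_big (fun g => g *: H)%g (mem (lcosets H G))) /=; last first.
    by move=> g gG; apply/lcosetsP; exists g.
  rewrite scaler_sumr; apply: eq_bigr => _ /lcosetsP[x xG ->].
  rewrite (eq_bigr (fun=> tact s (repr (x *: H)%g))); last first.
    move=> g /andP[_ /eqP gx].
    have : repr (x *: H)%g \in (x *: H)%g by apply: (mem_repr x); apply: lcoset_refl.
    by rewrite -gx => /lcosetP[h hH ->]; rewrite -tactM (fs _ hH).
  rewrite (eq_bigl (mem (x *: H)%g)) => [|g /=].
    by rewrite sumr_const card_lcoset scaler_nat.
  rewrite (sameP eqP lcoset_eqP); apply: andb_idl => /lcosetP[h hH ->].
  by rewrite groupM // (subsetP sHG).
exists s'; split=> // [g gG|P sP Ps].
  apply: (tensor_scaleI (cardG_gt0 H)); rewrite -tactZ E tact_sum.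
  rewrite [RHS](reindex_inj (mulgI g)); apply: eq_big => [h|h _].
    by rewrite groupMl.
  by rewrite tactM.
apply: submod_sum => // _ /lcosetsP[x xG ->]; apply: Ps.
have : repr (x *: H)%g \in (x *: H)%g by apply: (mem_repr x); apply: lcoset_refl.
by case/lcosetP => h hH ->; rewrite groupM // (subsetP sHG).
Qed.

Lemma ind_exists H s : fixed H s -> exists t, ind H s t.
Proof.
move=> fs; have [t [E _ _]] := coset_sum (subsetT H : H \subset [set: _]%G) fs.
by exists t; split=> //; rewrite E; apply: eq_bigl => g; rewrite inE.
Qed.

(** Induction in stages, used to enlarge the group under which the inducing
tensor is fixed. *)
Lemma ind_trans H G s t : H \subset G -> ind H s t ->
  exists2 s', ind G s' t
    & forall P, submodule P -> (forall g, g \in G -> P (tact s g)) -> P s'.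
Proof.
move=> sHG [fs E]; have [s' [E' fs' Ps']] := coset_sum sHG fs.
exists s' => //; split=> //; apply: (tensor_scaleI (cardG_gt0 H)).
rewrite -symZ E' sym_sum scalerA mulrC -scalerA E.
rewrite (eq_bigr (fun=> sym s)) => [|g _]; last exact: sym_tact.
by rewrite sumr_const scaler_nat.
Qed.

(** When H permutes the summands f b as it permutes positions, the translates
of the summands in one orbit have the same sum, and the orbit of b has size
#|H| / #|'C_H[b | 'P]|. The index of a summand is its orbit, since tau has to be
the same at all positions of an orbit. *)
Lemma ind_Mackey H (f : 'I_d -> tensor V d) t :
  (forall h b, h \in H -> tact (f (h b)) h = f b) ->
  ind H (\sum_b f b) t ->
  exists2 tau : {set 'I_d} -> tensor V d,
    t = \sum_(B in orbit 'P H @: setT) tau B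
    & forall b, ind 'C_H[b | 'P]%G (f b) (tau (orbit 'P H b)).
Proof.
move=> fH [_ E].
have Cfix b : fixed 'C_H[b | 'P]%G (f b).
  by move=> h /setIP[hH /astab1P]; rewrite /= apermE => hb; rewrite -{1}hb fH.
have /fin_all_exists[u uP] b := ind_exists (Cfix b).
have fE b h : h \in H -> sym (f (h b)) = sym (f b).
  by move=> hH; rewrite -(fH h b hH) sym_tact.
have uE b b' : b' \in orbit 'P H b -> u b' = u b.
  case/orbitP => h hH; rewrite /= apermE => hb.
  have c : #|'C_H[b' | 'P]%G| = #|'C_H[b | 'P]%G|.
    have o : orbit 'P H b' = orbit 'P H b.
      by apply/orbit_eqP/orbitP; exists h; rewrite //= apermE.
    have := card_orbit_stab 'P H b'; rewrite -(card_orbit_stab 'P H b) o.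
    move/eqP; rewrite eqn_pmul2l => [/eqP//|].
    by apply/card_gt0P; exists b; apply: orbit_refl.
  apply: (tensor_scaleI (cardG_gt0 'C_H[b | 'P]%G)).
  by rewrite -{1}c (uP b').2 (uP b).2 -hb fE.
pose tau (B : {set 'I_d}) := if [pick b in B] is Some b then u b else 0.
have tauE b : tau (orbit 'P H b) = u b.
  rewrite /tau; case: pickP => [b' /uE//|/(_ b)].
  by rewrite /= orbit_refl.
exists tau => [|b]; last by rewrite tauE.
apply: (tensor_scaleI (cardG_gt0 H)); rewrite E sym_sum scaler_sumr.
rewrite (partition_big (orbit 'P H) (mem (orbit 'P H @: setT))) /=; last first.
  by move=> b _; apply: imset_f.
apply: eq_bigr => _ /imsetP[b _ ->]; rewrite tauE.
rewrite (eq_bigr (fun=> sym (f b))) => [|b' /eqP ob]; last first.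
  have /orbitP[h hH <-] : b' \in orbit 'P H b by rewrite -ob orbit_refl.
  by rewrite /= apermE fE.
rewrite (eq_bigl (mem (orbit 'P H b))) => [|b' /=]; last first.
  by rewrite (sameP eqP orbit_eqP).
rewrite sumr_const -(uP b).2 -scaler_nat scalerA -natrM.
by rewrite (card_orbit_stab 'P H b).
Qed.

End Induction.

(** * Left multiplication of induced tensors *)

Section Products.
Variables (O : comNzRingType) (A : superalgebra O) (d : nat).
Implicit Types (s t xi : tensor A d) (g h : 'S_d).

Lemma tmul_pure_hom (x y : 'I_d -> A) (p q : 'I_d -> bool) :
  (forall a, hom (p a) (x a)) -> (forall a, hom (q a) (y a)) ->
  tmul (pure x) (pure y) = mulsgn O p q *: pure (fun a => x a ** y a).
Proof. exact: tmul_pure. Qed.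

Lemma tact_tmul s t g : tact (tmul s t) g = tmul (tact s g) (tact t g).
Proof.
move: s; apply: tensor_linear_eq => [c x y|c x y|w].
- by rewrite tmul_linl tact_linear.
- by rewrite tact_linear tmul_linl.
move: t; apply: tensor_linear_eq => [c x y|c x y|u].
- by rewrite tmul_linr tact_linear.
- by rewrite tact_linear tmul_linr.
have hb (z : word A d) a : hom (par (z a)) (bas (z a)) by apply: bas_hom.
rewrite (tmul_pure_hom (hb w) (hb u)) tactZ.
rewrite (tact_pure_hom g (@bas_mul_hom O A d w u)) !tact_bast.
have [_ _ -> _] := lin_props (tmul_linl (actsgn O g (par \o u) *: bast (wperm u g))).
have [_ _ -> _] := lin_props (tmul_linr (bast (wperm w g))).
rewrite (tmul_pure_hom (hb _) (hb _)) !scalerA mulrC.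
rewrite [X in X *: _]actsgn_addb; congr (_ *: _); last first.
  by apply: (pure_multilinear _ d).1 => a; rewrite !ffunE.
by congr (_ * _); apply: mulsgn_ext => a; rewrite /= ffunE.
Qed.

Lemma tmulZr c s t : tmul s (c *: t) = c *: tmul s t.
Proof. by have [] := lin_props (tmul_linr s). Qed.
Lemma tmul_sumr (I : Type) (r : seq I) (P : pred I) (F : I -> tensor A d) s :
  tmul s (\sum_(i <- r | P i) F i) = \sum_(i <- r | P i) tmul s (F i).
Proof. by have [] := lin_props (tmul_linr s). Qed.
Lemma tmul_suml (I : Type) (r : seq I) (P : pred I) (F : I -> tensor A d) s :
  tmul (\sum_(i <- r | P i) F i) s = \sum_(i <- r | P i) tmul (F i) s.
Proof. by have [] := lin_props (tmul_linl s). Qed.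

Lemma tmul_sym xi s : fixed setT xi -> tmul xi (sym s) = sym (tmul xi s).
Proof.
move=> fxi; rewrite tmul_sumr; apply: eq_bigr => g _.
by rewrite tact_tmul fxi ?inE.
Qed.

Lemma fixed_tmul (H : {set 'S_d}) s t : fixed H s -> fixed H t -> fixed H (tmul s t).
Proof. by move=> fs ft g gH; rewrite tact_tmul fs ?ft. Qed.

Lemma slots_tmul (R Q Q' : 'I_d -> A -> Prop) xi s :
  (forall a x y, R a x -> Q a y -> Q' a (x ** y)) ->
  slots R xi -> slots Q s -> slots Q' (tmul xi s).
Proof.
move=> RQ Rxi; apply: (lspan_ind (P := fun s => slots Q' (tmul xi s))).
  exact: submod_preim (tmul_linr xi) (slots_submod Q').
move=> _ [y [q [yP ->]]].
move: xi Rxi; apply: (lspan_ind (P := fun xi => slots Q' (tmul xi (pure y)))).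
  exact: submod_preim (tmul_linl (pure y)) (slots_submod Q').
move=> _ [x [p [xP ->]]].
rewrite (tmul_pure_hom (fun a => (xP a).1) (fun a => (yP a).1)).
apply: submodZ; first exact: slots_submod.
apply: (@slots_pure _ _ _ _ _ (fun a => p a (+) q a)) => a.
  by apply: smul_hom; [exact: (xP a).1 | exact: (yP a).1].
by apply: RQ; [exact: (xP a).2 | exact: (yP a).2].
Qed.

Definition spot (b : 'I_d) (y : A) : tensor A d :=
  pure (fun i => if i == b then y else sone).

Lemma spot_hom (b : 'I_d) (y : A) e : hom e y ->
  forall i, hom ((i == b) && e) (if i == b then y else sone).
Proof. by move=> hy i; case: ifP => // _; apply: sone_hom. Qed.

Lemma spot_linear b : linear (spot b).
Proof. by move=> c x y; apply: (pure_multilinear A d).2. Qed.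

Lemma tact_spot b y e g : hom e y -> tact (spot (g b) y) g = spot b y.
Proof.
move=> hy; rewrite (tact_pure_hom g (@spot_hom (g b) _ _ hy)) actsgn_single scale1r.
by apply: (pure_multilinear _ d).1 => i; rewrite (inj_eq perm_inj).
Qed.

Lemma slots_spot b y e : hom e y ->
  slots (fun a x => x = if a == b then y else sone) (spot b y).
Proof. by move=> hy; apply: slots_pure (@spot_hom b _ _ hy) _. Qed.

Lemma slots_spot_tmul (Q Q' : 'I_d -> A -> Prop) b y e s : hom e y ->
  (forall x, Q b x -> Q' b (y ** x)) ->
  (forall i x, i != b -> Q i x -> Q' i x) ->
  slots Q s -> slots Q' (tmul (spot b y) s).
Proof.
move=> hy Qb Qi; apply: slots_tmul (slots_spot b hy) => a x z ->.
by case: eqVneq => [->|ne Qz]; [exact: Qb | rewrite smul1l; exact: Qi].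
Qed.

(** This is 1^(d-1) * y, by [spread_shuffle]. *)
Definition spread (y : A) : tensor A d := \sum_b spot b y.

Lemma spread_linear : linear spread.
Proof. by move=> c x y; apply: sum_linear => b; apply: spot_linear. Qed.

Lemma fixed_spread y e : hom e y -> fixed setT (spread y).
Proof.
move=> hy g _; rewrite tact_sum (reindex_inj (@perm_inj _ g)).
by apply: eq_bigr => b _; apply: tact_spot hy.
Qed.

End Products.

Section Classes.
Variables (O : idomainType) (A : superalgebra O) (d : nat).
Hypothesis charO : forall n, (0 < n)%N -> n%:R != 0 :> O.
Implicit Types (s t xi : tensor A d) (g h : 'S_d) (J K M : {set 'I_d}).
Implicit Types (L : {set idx A}) (H G : {group 'S_d}).

Definition lets_on L J (a : 'I_d) (x : A) := a \in J -> lets L x.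

(** All subgroups of [Sym J] are allowed, since Mackey's formula yields
stabilizers; [ind_Sym] returns to [Sym J]. *)
Definition induced L : tensor A d -> Prop :=
  lspan (fun t => exists J (H : {group 'S_d}) s,
    [/\ H \subset Sym J, slots (lets_on L J) s & ind H s t]).

Lemma induced_submod L : submodule (induced L).
Proof. exact: lspan_submod. Qed.

Lemma induced_gen L J H s t :
  H \subset Sym J -> slots (lets_on L J) s -> ind H s t -> induced L t.
Proof. by move=> HJ Ls st; apply: lspan_gen; exists J, H, s. Qed.

Lemma Sym_setT : Sym [set: 'I_d] = [set: 'S_d].
Proof. by apply/setP => g; rewrite !inE; apply/subsetP => a; rewrite inE. Qed.

Lemma induced_Inv L t : fixed setT t -> slots (fun=> lets L) t -> induced L t.
Proof.
move=> ft Lt; apply: (@induced_gen _ setT [set: 'S_d]%G t) (ind_setT ft).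
  by rewrite Sym_setT.
by apply: slots_sub Lt => a x Lx _.
Qed.

Lemma ind_tmul H xi s t : fixed setT xi -> ind H s t -> ind H (tmul xi s) (tmul xi t).
Proof.
move=> fxi [fs E]; split; last by rewrite -tmul_sym // -E tmulZr.
by apply: fixed_tmul => //; apply: fixed_sub fxi; apply: subsetT.
Qed.

Lemma ind_spread H y e s t : hom e y -> ind H s t ->
  exists2 tau : {set 'I_d} -> tensor A d,
    tmul (spread d y) t = \sum_(B in orbit 'P H @: setT) tau B
    & forall b, ind 'C_H[b | 'P]%G (tmul (spot b y) s) (tau (orbit 'P H b)).
Proof.
move=> hy st; apply: (ind_Mackey charO) => [h b hH|].
  by rewrite tact_tmul (tact_spot b h hy) (st.1 _ hH).
by rewrite -tmul_suml; apply: ind_tmul st; apply: fixed_spread hy.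
Qed.

(** Multiplication by an invariant tensor commutes with induction, so it acts
on the inducing tensor. *)
Lemma induced_Inv_tmul L xi t :
  (forall x y, lets L x -> lets L y -> lets L (x ** y)) ->
  fixed setT xi -> slots (fun=> lets L) xi -> induced L t -> induced L (tmul xi t).
Proof.
move=> LM fxi Lxi; apply: (lspan_ind (P := fun t => induced L (tmul xi t))).
  exact: submod_preim (tmul_linr xi) (induced_submod L).
move=> {}t [J [H [s [HJ Ls st]]]].
apply: (induced_gen HJ _ (ind_tmul fxi st)).
by apply: slots_tmul Lxi Ls => a x y Lx Ly aJ; apply: LM (Ly aJ).
Qed.

Lemma astab1_Sym H J b : H \subset Sym J -> 'C_H[b | 'P]%g \subset Sym (J :\ b).
Proof.
move=> /subsetP HJ; apply/subsetP => g /setIP[/HJ gJ /astab1P gb]; rewrite !inE in gJ *.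
apply/subsetP => a; rewrite !inE => ne; rewrite (subsetP gJ) // andbT.
by apply: contraNneq ne => ->; rewrite -[X in _ == X]gb.
Qed.

(** In the term of Mackey's formula where y falls on the position b, nothing
is known about the new letter at b, but b may be taken out of J because the
stabilizer of b does not move it. *)
Lemma induced_spread_tmul L y e t :
  hom e y -> induced L t -> induced L (tmul (spread d y) t).
Proof.
move=> hy; apply: (lspan_ind (P := fun t => induced L (tmul _ t))).
  exact: submod_preim (tmul_linr _) (induced_submod L).
move=> {}t [J [H [s [HJ Ls st]]]].
have [tau -> tauP] := ind_spread hy st.
apply: submod_sum => [|_ /imsetP[b _ ->]]; first exact: induced_submod.
apply: (induced_gen (astab1_Sym b HJ) _ (tauP b)).
apply: slots_spot_tmul hy _ _ Ls => [x _|i x ne Lx]; first by rewrite /lets_on !inE eqxx.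
by rewrite /lets_on !inE ne.
Qed.

End Classes.

(** * Slicing a tensor at one position *)

Section Slicing.
Variables (O : comNzRingType) (A : superalgebra O) (d : nat).
Variable L0 : {set idx A}.
Hypothesis evenL : forall i, i \in L0 -> par i = false.
Implicit Types (s t : tensor A d) (g h : 'S_d) (K M : {set 'I_d}).

Definition pattern K M (a : 'I_d) (x : A) :=
  (a \in K -> lets L0 x) /\ (a \in M -> x = sone).

(** For disjoint K and M this is the product of their symmetric groups; the
description by a normalizer makes its stabilizers easy to identify. *)
Definition block K M : {group 'S_d} := 'N_(Sym (K :|: M))(K | 'P)%G.

Lemma blockP K M g : reflect
  (perm_on (K :|: M) g /\ forall a, (g a \in K) = (a \in K)) (g \in block K M).
Proof.
apply: (iffP setIP) => [[gJ gN]|[gJ gK]]; split; rewrite ?inE // in gJ *.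
- by move=> a; rewrite -[g a]/('P%act a g) (astabs_act _ gN).
- by apply/subsetP => a aK; rewrite inE /= apermE gK.
Qed.

Lemma lets_even x : lets L0 x -> hom false x.
Proof. by move=> Lx i pi; apply: Lx; apply: contra pi => /evenL ->. Qed.

(** A zero entry may have been declared odd; parities can be chosen so that
the entries in K and M count as even. *)
Lemma pattern_parity K M (v : 'I_d -> A) (p : 'I_d -> bool) :
  (forall a, hom (p a) (v a) /\ pattern K M a (v a)) ->
  exists2 q : 'I_d -> bool, forall a, hom (q a) (v a) &
    {in K :|: M, q =1 xpred0}.
Proof.
move=> vP; exists (fun a => (a \notin K :|: M) && p a) => [a|a /= ->//].
case: (boolP (a \in _)) => [/setUP[aK|aM]|_] /=; last exact: (vP a).1.
  exact/lets_even/((vP a).2.1 aK).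
by rewrite ((vP a).2.2 aM); apply: sone_hom.
Qed.

(** Entries in K and M are even, so there are no signs, and the entries in M
are all equal, so only the effect on K is seen. *)
Lemma tact_pattern K M s g h : slots (pattern K M) s ->
  perm_on (K :|: M) g -> perm_on (K :|: M) h ->
  (forall a, a \in K -> g a = h a) ->
  (forall a, a \in M -> a \notin K -> g a \in M /\ h a \in M) ->
  tact s g = tact s h.
Proof.
move=> Qs gJ hJ ghK ghM; move: s Qs; apply: lspan_ind.
  by apply: submod_eq; apply: tact_linear.
move=> _ [v [p [vP ->]]]; have [q qv q0] := pattern_parity vP.
rewrite !(tact_pure_hom _ qv) !(@actsgn_even _ _ _ _ (K :|: M)) // !scale1r.
apply: (pure_multilinear _ d).1 => a.
have [aK|aK] := boolP (a \in K); first by rewrite ghK.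
have [aM|aM] := boolP (a \in M); last first.
  by rewrite !(out_perm _ (_ : a \notin K :|: M)) // inE negb_or aK.
by have [gM hM] := ghM a aM aK; rewrite !(vP _).2.2.
Qed.

Lemma fixed_block K M s : [disjoint K & M] -> slots (pattern K M) s ->
  fixed (Sym K) s -> fixed (block K M) s.
Proof.
move=> dKM Qs fs g gB; have /blockP[gJ gK] := gB.
have gN : g \in 'N(K | 'P)%g by case/setIP: gB.
have kE : restr_perm K g \in Sym K by rewrite inE restr_perm_on.
rewrite -[RHS](fs _ kE); apply: (tact_pattern Qs gJ) => [|a aK|a aM aK].
- apply/subsetP => a ne; rewrite inE (subsetP (restr_perm_on K g)) //.
- by rewrite restr_permE.
rewrite (out_perm (restr_perm_on K g)) //; split=> //.
have : g a \in K :|: M by rewrite (perm_closed _ gJ) inE aM orbT.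
by rewrite inE gK (negPf aK).
Qed.

Lemma slots_pattern_block K M g s : g \in block K M -> [disjoint K & M] ->
  slots (pattern K M) s -> slots (pattern K M) (tact s g).
Proof.
case/blockP => gJ gK dKM; apply: slots_tact => a x [QK QM].
split=> [aK|aM]; first by apply: QK; rewrite gK.
apply: QM; have : g a \in K :|: M by rewrite (perm_closed _ gJ) inE aM orbT.
have /negPf aK : a \notin K.
  by apply/negP => aK; have /pred0P/(_ a) := dKM; rewrite /= aK aM.
by rewrite inE gK aK.
Qed.

Definition upd (T : Type) (v : 'I_d -> T) a x := fun i => if i == a then x else v i.

Definition spot_par (a : 'I_d) (e : bool) (i : 'I_d) := (i == a) && e.

(** The entry at position a is replaced by its coordinate on the letter l,
times 1. The sign is that of l passing the entries before a; it compensates the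
sign that arises when l is multiplied back at position a, see [slice]. *)
Definition cut (a : 'I_d) (l : idx A) s : tensor A d :=
  [ffun w : word A d => mulsgn O (spot_par a (par l)) (par \o w) *
    dbas (w a) sone * (s (finfun (upd w a l)) : O)].

Lemma cutE a l s w : cut a l s w = mulsgn O (spot_par a (par l)) (par \o w) *
  dbas (w a) sone * (s (finfun (upd w a l)) : O) :> O.
Proof. by rewrite ffunE. Qed.

Lemma cut_linear a l : linear (cut a l).
Proof.
move=> c s t; apply/ffunP => w; rewrite tensor_linE !cutE tensor_linE.
by rewrite mulrDr [_ * (c * _)]mulrCA.
Qed.

Lemma mulsgn_spot a e p q : (forall i, i != a -> p i = q i) ->
  mulsgn O (spot_par a e) p = mulsgn O (spot_par a e) q.
Proof.
move=> pq; rewrite !mulsgnE; apply: eq_bigr => i _; apply: eq_bigr => c lt_ic.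
rewrite /spot_par; have [ca|//] := eqVneq c a.
by rewrite pq // -ca (lt_neq lt_ic).
Qed.

Lemma cut_pure a l (v : 'I_d -> A) p : (forall i, hom (p i) (v i)) ->
  cut a l (pure v) = (mulsgn O (spot_par a (par l)) p * dbas l (v a)) *:
    pure (upd v a sone).
Proof.
move=> vp; apply/ffunP => w; rewrite tensorZE !ffunE (bigD1 a) //= [in RHS](bigD1 a) //=.
rewrite /upd !ffunE eqxx.
under eq_bigr => i ne do rewrite ffunE (negPf ne).
under [in RHS]eq_bigr => i ne do rewrite (negPf ne).
have [->|nz] := eqVneq (\prod_(i < d | i != a) dbas (w i) (v i)) 0.
  by rewrite !mulr0.
rewrite (@mulsgn_spot _ _ _ p) => [|i ne]; last first.
  apply: dbas_hom (vp i) _; apply: contraNneq nz => z0.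
  by rewrite (bigD1 i) //= z0 mul0r.
by rewrite -!mulrA; congr (_ * _); rewrite mulrCA.
Qed.

Lemma upd_linear a (v : 'I_d -> A) : linear (fun x => pure (upd v a x)).
Proof. by move=> c x y; apply: (pure_multilinear A d).2. Qed.

Lemma upd_hom a (v : 'I_d -> A) p x e : (forall i, hom (p i) (v i)) -> hom e x ->
  forall i, hom (upd p a e i) (upd v a x i).
Proof. by move=> vp hx i; rewrite /upd; case: ifP. Qed.

Lemma spot_cut_pure a l (v : 'I_d -> A) p : (forall i, hom (p i) (v i)) ->
  tmul (spot a (bas l)) (cut a l (pure v)) = dbas l (v a) *: pure (upd v a (bas l)).
Proof.
move=> vp; rewrite (cut_pure _ _ vp) tmulZr.
rewrite (tmul_pure_hom (@spot_hom _ _ _ a _ _ (bas_hom l)) (@upd_hom a _ _ _ _ vp (sone_hom A))).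
rewrite scalerA mulrC mulrA (@mulsgn_spot _ _ _ p) => [|i ne]; last by rewrite /upd (negPf ne).
rewrite -expr2 sqrr_sign mul1r; congr (_ *: _).
apply: (pure_multilinear A d).1 => i; rewrite /upd.
by case: ifP => _; rewrite ?smul1r ?smul1l.
Qed.

Lemma slice K M a s : a \notin K -> slots (pattern K M) s ->
  s = \sum_l tmul (spot a (bas l)) (cut a l s).
Proof.
move=> aK; move: s; apply: lspan_ind.
  apply: submod_eq => // c x y.
  by apply: sum_linear => l; rewrite cut_linear tmul_linr.
move=> _ [v [p [vP ->]]].
under eq_bigr => l _ do rewrite (spot_cut_pure _ _ (fun i => (vP i).1)).
have -> : pure v = pure (upd v a (\sum_l dbas l (v a) *: bas l)).
  by apply: (pure_multilinear A d).1 => i; rewrite /upd -bas_sum; case: eqP => [->|].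
have [_ _ Z S] := lin_props (upd_linear a v).
by rewrite S; apply: eq_bigr => l _; rewrite Z.
Qed.

Lemma slots_cut K M a l s : a \notin K -> slots (pattern K M) s ->
  slots (pattern K (a |: M)) (cut a l s).
Proof.
move=> aK; apply: (lspan_ind (P := fun s => slots _ (cut a l s))).
  exact: submod_preim (cut_linear a l) (slots_submod _).
move=> _ [v [p [vP ->]]]; rewrite (cut_pure _ _ (fun i => (vP i).1)).
apply: submodZ; first exact: slots_submod.
apply: (slots_pure (@upd_hom a _ _ _ _ (fun i => (vP i).1) (sone_hom A))) => i.
rewrite /upd; case: eqVneq => [->|ne]; split=> // iK.
- by rewrite iK in aK.
- exact: (vP i).2.1.
- by move: iK; rewrite in_setU1 (negPf ne) => /(vP i).2.2.
Qed.

(** No sign arises from the odd letter l that [cut] removes, because the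
letters that g moves are even. *)
Lemma tact_cut K M a l s g : a \notin K -> perm_on K g ->
  slots (pattern K M) s -> tact (cut a l s) g = cut a l (tact s g).
Proof.
move=> aK gK; have ga := out_perm gK aK; move: s; apply: lspan_ind.
  by apply: submod_eq => c x y; rewrite ?(tact_linear, cut_linear).
move=> _ [v [p [vP ->]]]; have [q qv q0] := pattern_parity vP.
have qK : {in K, q =1 xpred0} by move=> i iK; rewrite q0 // inE iK.
rewrite (tact_pure_hom g qv) (actsgn_even _ qK gK) scale1r.
rewrite (cut_pure _ _ qv) (cut_pure _ _ (fun i => qv (g i))) tactZ.
rewrite (tact_pure_hom g (@upd_hom a _ _ _ _ qv (sone_hom A))) (@actsgn_even _ _ _ _ K) //; last first.
  move=> i iK; rewrite /upd; have [ia|_] := eqVneq i a; last exact: qK.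
  by rewrite -ia iK in aK.
rewrite scale1r ga; congr (_ * _ *: _).
  apply: mulsgn_spot => i _; have [iK|iK] := boolP (i \in K).
    by rewrite !qK // perm_closed.
  by rewrite (out_perm gK).
apply: (pure_multilinear A d).1 => i.
by rewrite /upd -{1}ga (inj_eq perm_inj).
Qed.

End Slicing.

(** * Generation of the tensors induced from even letters *)

Section Generation.
Variables (O : idomainType) (A : superalgebra O) (d : nat).
Hypothesis charO : forall n, (0 < n)%N -> n%:R != 0 :> O.
Variable L0 : {set idx A}.
Hypothesis evenL : forall i, i \in L0 -> par i = false.
Hypothesis L0_one : lets L0 sone.
Variable R : tensor A d -> Prop.
Hypothesis R_submod : submodule R.
Hypothesis R_Inv : forall t, fixed setT t -> slots (fun=> lets L0) t -> R t.
Hypothesis R_spread : forall l t, l \notin L0 -> R t -> R (tmul (spread d (bas l)) t).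
Implicit Types (s t : tensor A d) (g h : 'S_d) (J K M : {set 'I_d}) (H : {group 'S_d}).

Lemma slots_pattern_on K M s :
  slots (pattern L0 K M) s -> slots (lets_on L0 (K :|: M)) s.
Proof. by apply: slots_sub => a x [QK QM] /setUP[/QK //|/QM ->]. Qed.

Lemma block_sub K M : block K M \subset Sym (K :|: M).
Proof. exact: subsetIl. Qed.

Lemma sub_Sym J J' : J \subset J' -> Sym J \subset Sym J'.
Proof.
move=> /subsetP JJ'; apply/subsetP => g; rewrite !inE => /subsetP gJ.
by apply/subsetP => a /gJ /JJ'.
Qed.

Definition reached e := forall J H s t, (#|~: J| <= e)%N ->
  H \subset Sym J -> slots (lets_on L0 J) s -> ind H s t -> R t.

(** Here s may be taken invariant under all permutations, and then t = s. *)
Lemma reached0 : reached 0.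
Proof.
move=> J H s t; rewrite leqn0 cards_eq0 -subset0 => J0 _ Ls st.
have aJ a : a \in J by have := subsetP J0 a; rewrite !inE; case: (a \in J) => // /(_ isT).
have [s' st' Ps'] := ind_trans charO (subsetT H : H \subset [set: 'S_d]%G) st.
rewrite (ind_uniq charO st' (ind_setT st'.1 : ind _ s' s')).
apply: R_Inv; first exact: st'.1.
apply: (Ps' (slots (fun=> lets L0))); first exact: slots_submod.
by move=> g _; apply: slots_tact Ls => a x; apply.
Qed.

(** The stabilizer of the position that comes back is exactly the group from
which the wanted tensor is induced; an inclusion would not suffice. *)
Lemma block_stab K M a : a \notin K -> a \notin M ->
  'C_(block K (a |: M))[a | 'P]%G = block K M.
Proof.
move=> aK aM; apply/val_inj/setP => g /=; apply/setIP/idP => [[/blockP[gJ gK] /astab1P ga]|].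
  apply/blockP; split=> //; apply/subsetP => i ne.
  have := subsetP gJ i ne; rewrite !inE; case/or3P => [->//|/eqP ia|->]; last by rewrite orbT.
  by move: ne; rewrite ia inE -{2}ga eqxx.
case/blockP => gJ gK; split.
  apply/blockP; split=> //; apply/subsetP => i ne.
  by have := subsetP gJ i ne; rewrite !inE => /orP[->|->]; rewrite ?orbT.
by apply/astab1P/(out_perm gJ); rewrite inE negb_or aK.
Qed.

Lemma block_stab_sub K M b : b \in K -> b \notin M ->
  'C_(block K M)[b | 'P]%g \subset block (K :\ b) M.
Proof.
move=> bK bM; apply/subsetP => g /setIP[/blockP[gJ gK] /astab1P gb].
apply/blockP; split=> [|i].
  apply/subsetP => i ne; have := subsetP gJ i ne; rewrite !inE => /orP[->|->].
    rewrite andbT; apply/orP; left; apply: contraTneq ne => ->.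
    by rewrite inE negbK; apply/eqP.
  by rewrite orbT.
by rewrite !inE gK -{1}gb (inj_eq perm_inj).
Qed.

(** The passage from e to e + 1 positions outside, by an inner induction on the
size of the set K of positions that carry arbitrary letters of L0. *)
Lemma reached_pattern e : reached e ->
  forall k K M H s t, (#|K| < k)%N -> [disjoint K & M] -> (#|~: (K :|: M)| <= e.+1)%N ->
    H \subset block K M -> slots (pattern L0 K M) s -> ind H s t -> R t.
Proof.
move=> IHe; elim=> [//|k IHk] K M H s t leK dKM leKM HB Qs st.
have [KM0|/set0Pn[a]] := eqVneq (~: (K :|: M)) set0.
  apply: (IHe (K :|: M) H s) => //; first by rewrite KM0 cards0.
    exact: subset_trans HB (block_sub K M).
  exact: slots_pattern_on.
rewrite in_setC in_setU negb_or => /andP[aK aM].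
have {H HB s Qs st} [s st Qs] : exists2 s, ind (block K M) s t & slots (pattern L0 K M) s.
  have [s' st' Ps'] := ind_trans charO HB st; exists s' => //.
  by apply: Ps' => [|g gB]; [exact: slots_submod | exact: slots_pattern_block].
(* The entry at a is cut off: s is the sum over l of l multiplied at a with u l,
   which carries 1 at a. *)
have sB : Sym K \subset block K M.
  apply/subsetP => g; rewrite inE => gK; apply/blockP; split=> [|i].
    by apply/subsetP => i /(subsetP gK); rewrite inE => ->.
  exact: perm_closed.
have fs : fixed (Sym K) s := fixed_sub sB st.1.
pose M' := a |: M; pose u l := cut a l s.
have dKM' : [disjoint K & M'].
  by rewrite disjoint_sym disjoints_subset subUset sub1set inE aK -disjoints_subset disjoint_sym.
have leKM' : (#|~: (K :|: M')| <= e)%N.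
  have aC : a \in ~: (K :|: M) by rewrite !inE negb_or aK.
  move: leKM; rewrite (cardsD1 a) aC add1n ltnS; congr (_ <= _)%N.
  by apply: eq_card => i; rewrite !inE; case: eqP; rewrite ?orbT.
have Qu l : slots (pattern L0 K M') (u l) by apply: slots_cut.
have fu l : fixed (Sym K) (u l).
  by move=> g; rewrite inE => gK; rewrite (tact_cut evenL l aK gK Qs) fs ?inE.
have Qf l : slots (pattern L0 K M) (tmul (spot a (bas l)) (u l)).
  apply: (slots_spot_tmul (bas_hom l)) (Qu l) => [x _|i x ne [QK QM]].
    by split=> aX; [rewrite aX in aK | rewrite aX in aM].
  by split=> // iM; apply: QM; rewrite in_setU1 iM orbT.
have ff l : fixed (block K M) (tmul (spot a (bas l)) (u l)).
  apply: (fixed_block evenL dKM (Qf l)) => g gK; rewrite tact_tmul (fu l g gK).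
  have ga : g a = a by rewrite inE in gK; apply: out_perm aK.
  by rewrite -{1}ga (tact_spot _ _ (bas_hom l)).
have /fin_all_exists[f fP] l := ind_exists charO (ff l).
have -> : t = \sum_l f l.
  apply: (ind_uniq charO st); rewrite {1}(slice aK Qs).
  exact: ind_sum.
(* If l is in L0 then a can be added to J. Otherwise t' below is induced from u l
   with a among the positions that carry 1. *)
apply: submod_sum => // l _; have [lL|lL] := boolP (l \in L0).
  apply: (IHe (K :|: M') (block K M) _ _ leKM' _ _ (fP l)).
    by apply: subset_trans (block_sub _ _) (sub_Sym _); rewrite setUS // subsetUr.
  apply: (slots_spot_tmul (bas_hom l) _ _ (Qu l)) => [x [_ QM] _|i x _ [QK QM]].
    by rewrite QM ?setU11 // smul1r; apply: lets_bas.
  by case/setUP => [/QK//|/QM->].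
have fu' : fixed (block K M') (u l) by apply: (fixed_block evenL).
have [t' st'] := ind_exists charO fu'.
have Rt' : R t'.
  by apply: (IHe _ _ _ _ leKM' (block_sub K M') _ st'); apply: slots_pattern_on.
(* Of the terms of Mackey's formula for the product with the spread of l, the
   one at the orbit of a is f l; the others are in R. *)
have := R_spread lL Rt'.
have [tau -> tauP] := ind_spread charO (bas_hom l) st'.
rewrite (bigD1 (orbit 'P (block K M') a)) ?(imset_f _ (in_setT a)) //=.
have := tauP a; rewrite (block_stab aK aM) => /(ind_uniq charO (fP l)) <-.
set rest := \sum_(B in _ | _) _ => Rall.
suff Rrest : R rest by rewrite -[f l](addrK rest); apply: submodB.
apply: submod_sum => // _ /andP[/imsetP[b _ ->] ne].
(* The positions of M' all carry 1 and form the orbit of a. *)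
have bM' : b \notin M'.
  apply: contra ne => bM'; apply/eqP/orbit_eqP.
  apply/orbitP; exists (tperm a b); last by rewrite /= apermE tpermL.
  have [aM' bK] : a \in M' /\ b \notin K.
    rewrite setU11; split=> //; apply/negP => bK.
    by have /pred0P/(_ b) := dKM'; rewrite /= bK bM'.
  apply/blockP; split=> [|i].
    apply: subset_trans (tperm_on a b) _; apply/subsetP => i /set2P[]->.
      by rewrite inE aM' orbT.
    by rewrite inE bM' orbT.
  by case: tpermP => // ->; rewrite ?(negPf aK) ?(negPf bK).
(* If b is in K, then b leaves K and the induction on the size of K applies.
   Otherwise K and M' together miss only e positions. *)
have [bK|bK] := boolP (b \in K).
  apply: (IHk (K :\ b) M' _ _ _ _ _ _ (block_stab_sub bK bM') _ (tauP b)).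
  - by move: leK; rewrite (cardsD1 b K) bK.
  - by apply: disjointWl dKM'; apply: subsetDl.
  - apply: leq_trans (_ : #|b |: ~: (K :|: M')| <= _)%N; last first.
      by rewrite cardsU1 -add1n leq_add // leq_b1.
    apply/subset_leq_card/subsetP => i; rewrite !inE.
    by case: (i == b) => //=; rewrite orbF.
  apply: (slots_spot_tmul (bas_hom l) _ _ (Qu l)) => [x _|i x nib [QK QM]].
    by split; [rewrite !inE eqxx | move=> bM; rewrite bM in bM'].
  by split=> //; rewrite !inE nib.
apply: (IHe (K :|: M') _ _ _ leKM' _ _ (tauP b)).
  exact: subset_trans (subsetIl _ _) (block_sub K M').
apply: (slots_spot_tmul (bas_hom l) _ _ (Qu l)) => [x _|i x _ [QK QM]].
  by rewrite /lets_on inE (negPf bK) (negPf bM').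
by case/setUP => [/QK//|/QM->].
Qed.

Lemma reached_all e : reached e.
Proof.
elim: e => [|e IHe]; first exact: reached0.
move=> J H s t leJ HJ Ls st.
apply: (@reached_pattern e IHe #|J|.+1 J set0 H s) => //.
- by rewrite disjoint_sym disjoints_subset sub0set.
- by rewrite setU0.
- apply: subset_trans HJ _; apply/subsetP => g; rewrite inE => gJ.
  by apply/blockP; split=> [|i]; [rewrite setU0 | exact: perm_closed].
- by apply: slots_sub Ls => a x Qx; split=> //; rewrite inE.
Qed.

Lemma induced_sub_closed t : induced L0 t -> R t.
Proof.
move: t; apply: lspan_ind => // t [J [H [s [HJ Ls st]]]].
exact: (reached_all (leqnn _) HJ Ls st).
Qed.

End Generation.

(** * Removing odd letters *)

Section Restriction.
Variables (O : comNzRingType) (V : supermodule O) (d : nat).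
Implicit Types (s t : tensor V d) (phi : pred (word V d)).

Definition restrict phi s : tensor V d := [ffun w => if phi w then s w else 0].

Lemma restrictE phi s w : restrict phi s w = if phi w then s w else 0.
Proof. by rewrite ffunE. Qed.

Lemma tact_restrict phi s g :
  tact (restrict phi s) g = restrict (fun w => phi (wperm w g^-1)) (tact s g).
Proof.
apply/ffunP => w; rewrite restrictE !tactE restrictE.
by case: ifP => // _; rewrite mulr0.
Qed.

Lemma restrict_ext phi psi s : phi =1 psi -> restrict phi s = restrict psi s.
Proof. by move=> E; apply/ffunP => w; rewrite !restrictE E. Qed.

End Restriction.

Section OddLetters.
Variables (O : idomainType) (A : superalgebra O) (d : nat).
Hypothesis charO : forall n, (0 < n)%N -> n%:R != 0 :> O.
Implicit Types (s t : tensor A d) (g h : 'S_d) (J : {set 'I_d}) (L : {set idx A}).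

Lemma slots_lets_onP L J s : slots (lets_on L J) s <->
  (forall w, s w != 0 -> forall a, a \in J -> w a \in L).
Proof.
have E a x : lets_on L J a x <-> lets (if a \in J then L else setT) x.
  rewrite /lets_on; case: ifP => aJ; first by split=> [/(_ isT)|Lx _].
  by split=> // _ i; rewrite inE.
split=> [Ls w nz a aJ|Ls].
  have /slots_letsP/(_ w nz a) : slots (fun a => lets (if a \in J then L else setT)) s.
    by apply: slots_sub Ls => b x /E.
  by rewrite aJ.
apply: (@slots_sub _ _ _ (fun a => lets (if a \in J then L else setT))).
  by move=> a x /E.
by apply/slots_letsP => w nz a; case: ifP => // aJ; exact: Ls.
Qed.

(** The transposition of the two equal letters fixes the word and changes the
sign, so twice the coefficient is zero. *)
Lemma odd_letter_once J s (w : word A d) (a c : 'I_d) :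
  fixed (Sym J) s -> a != c -> a \in J -> c \in J -> w a = w c -> par (w a) ->
  s w = 0.
Proof.
move=> fs ne aJ cJ wac pa.
have gJ : tperm a c \in Sym J.
  rewrite inE; apply: subset_trans (tperm_on a c) _.
  by apply/subsetP => i /set2P[]->.
have wE : wperm w (tperm a c)^-1 = w.
  by apply/ffunP => i; rewrite ffunE tpermV; case: tpermP => // ->.
have := tactE s (tperm a c) w; rewrite (fs _ gJ) wE actsgn_tperm //=; last by rewrite -wac.
rewrite mulN1r => /eqP; rewrite -subr_eq0 opprK -mulr2n -mulr_natl mulf_eq0.
by rewrite (negPf (charO _)) //= => /eqP.
Qed.

Lemma ind_Sym L J (H : {group 'S_d}) s t :
  H \subset Sym J -> slots (lets_on L J) s -> ind H s t ->
  exists2 s', slots (lets_on L J) s' & ind (Sym J)%G s' t.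
Proof.
move=> HJ Ls st; have [s' st' Ps'] := ind_trans charO HJ st.
exists s' => //; apply: Ps' => [|g]; first exact: slots_submod.
rewrite inE => gJ; apply: slots_tact Ls => a x Lx aJ; apply: Lx.
by rewrite perm_closed.
Qed.

(** The words in which l does not occur in J are already as wanted. The others
are sorted by the position b of l: these parts are permuted by Sym J, and Mackey's
formula gives tensors induced from the stabilizers of b, so that b can leave J. *)
Lemma induced_pull L l t : par l -> induced L t -> induced (L :\ l) t.
Proof.
move=> pl; move: t; apply: lspan_ind; first exact: induced_submod.
move=> t [J [H [_ [HJ /(ind_Sym HJ) Ls /Ls[s {}Ls st]]]]].
have fs := st.1.
pose s0 := restrict (fun w => [forall a in J, w a != l]) s.
pose f b := if b \in J then restrict (fun w => w b == l) s else 0.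
have twice (w : word A d) a c : a != c -> a \in J -> c \in J -> w a = l -> w c = l ->
    s w = 0.
  by move=> ne aJ cJ wa wc; apply: (odd_letter_once fs ne) => //; rewrite wa ?wc.
have sE : s = s0 + \sum_b f b.
  apply/ffunP => w; rewrite tensorDE sum_ffunE restrictE.
  have fE b : f b w = if (b \in J) && (w b == l) then s w else 0.
    by rewrite /f; case: ifP => _; rewrite ?restrictE // ffunE.
  under eq_bigr do rewrite fE.
  case: ifP => [/forall_inP none|/negbT/forall_inPn[a aJ]].
    rewrite big1 ?addr0 // => b _; case: ifP => // /andP[bJ wb].
    by have := none b bJ; rewrite wb.
  rewrite negbK => /eqP wa; rewrite add0r (bigD1 a) //= aJ wa eqxx /=.
  rewrite big1 ?addr0 // => b ne; case: ifP => // /andP[bJ /eqP wb].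
  exact: (twice _ _ _ ne).
have fs0 : fixed (Sym J) s0.
  move=> g gJ; rewrite tact_restrict (fs _ gJ); apply: restrict_ext => w.
  rewrite inE in gJ; apply/forall_inP/forall_inP => none a aJ.
    by have := none (g a); rewrite ffunE permK perm_closed //; apply.
  by rewrite ffunE; apply: none; rewrite perm_closed // perm_onV.
have fH g b : g \in Sym J -> tact (f (g b)) g = f b.
  move=> gJ; rewrite /f perm_closed; last by rewrite inE in gJ.
  case: ifP => _; last exact: tact0.
  rewrite tact_restrict (fs _ gJ); apply: restrict_ext => w.
  by rewrite ffunE permK.
have [t0 st0] := ind_exists charO (fs0 : fixed (Sym J)%G s0).
have ff : fixed (Sym J)%G (\sum_b f b).
  move=> g gJ; rewrite tact_sum (reindex_inj (@perm_inj _ g)).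
  by apply: eq_bigr => b _; apply: fH.
have [t1 st1] := ind_exists charO ff.
have -> : t = t0 + t1 by apply: (ind_uniq charO st); rewrite {1}sE; apply: ind_add.
apply: submodD; first exact: induced_submod.
  apply: (induced_gen _ _ st0); first exact: subxx.
  apply/slots_lets_onP => w; rewrite restrictE; case: ifP; last by rewrite eqxx.
  move=> /forall_inP none nz a aJ; rewrite !inE none //.
  exact: (proj1 (slots_lets_onP _ _ _) Ls w nz).
have [tau -> tauP] := ind_Mackey charO fH st1.
apply: submod_sum => [|_ /imsetP[b _ ->]]; first exact: induced_submod.
apply: (induced_gen _ _ (tauP b)); first by apply: astab1_Sym; apply: subxx.
apply/slots_lets_onP => w; rewrite /f; case: ifP => bJ; last by rewrite ffunE eqxx.
rewrite restrictE; case: ifP => [/eqP wb nz|]; last by rewrite eqxx.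
move=> a /setD1P[ne aJ]; rewrite !inE (proj1 (slots_lets_onP _ _ _) Ls w nz) // andbT.
by apply: contraNneq nz => wa; apply/eqP; apply: (twice _ _ _ ne).
Qed.

Lemma induced_even L t : induced L t -> induced [set i in L | ~~ par i] t.
Proof.
elim: {L}_.+1 {-2}L (ltnSn #|[set i in L | par i]|) => // n IHn L leL Lt.
have [L0|/set0Pn[l]] := eqVneq [set i in L | par i] set0.
  suff <- : L = [set i in L | ~~ par i] by [].
  apply/setP => i; have := in_set0 i; rewrite -L0 !inE.
  by case: (i \in L) => //= ->.
rewrite inE => /andP[lL pl].
have -> : [set i in L | ~~ par i] = [set i in L :\ l | ~~ par i].
  by apply/setP => i; rewrite !inE; case: eqP => // ->; rewrite pl andbF.
apply: IHn (induced_pull pl Lt); rewrite ltnS in leL; apply: leq_trans leL.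
apply/proper_card/properP; split; first by apply/subsetP => i; rewrite !inE => /andP[/andP[_ ->]].
by exists l; rewrite !inE ?lL ?eqxx.
Qed.

End OddLetters.

(** * Shortest coset representatives of Young subgroups *)

Lemma perm_increasing N (s : 'S_N) :
  (forall i j : 'I_N, (i < j)%N -> (s i < s j)%N) -> s = 1%g.
Proof.
have le_incr (r : 'S_N) : (forall i j : 'I_N, (i < j)%N -> (r i < r j)%N) ->
    forall i : 'I_N, (i <= r i)%N.
  move=> incr [k lt_kN]; elim: k lt_kN => [//|k IHk] lt_kN.
  apply: leq_ltn_trans (IHk (ltnW lt_kN)) _; exact: incr.
move=> incr; have incrV (i j : 'I_N) : (i < j)%N -> (s^-1%g i < s^-1%g j)%N.
  move=> lt_ij; rewrite ord_ltnNge ?(inj_eq perm_inj) ?lt_neq //.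
  by apply: contraL lt_ij => /incr; rewrite !permKV -leqNgt => /ltnW.
apply/permP => i; rewrite perm1; apply/val_inj/eqP; rewrite eqn_leq le_incr // andbT.
by rewrite -{2}(permK s i) le_incr.
Qed.

Section Young.
Variables m n : nat.
Implicit Types (g h : 'S_(m + n)).

Lemma youngP h : reflect (forall i, (h i < m)%N = (i < m)%N) (young h).
Proof. by apply: (iffP forallP) => yh i; [exact: (eqP (yh i)) | rewrite yh]. Qed.

Lemma young1 : young (1%g : 'S_(m + n)).
Proof. by apply/youngP => i; rewrite perm1. Qed.

Lemma youngM h h' : young h -> young h' -> young (h * h')%g.
Proof. by move=> /youngP yh /youngP yh'; apply/youngP => i; rewrite permM yh' yh. Qed.

Lemma youngV h : young h -> young h^-1%g.
Proof. by move=> /youngP yh; apply/youngP => i; rewrite -{2}(permKV h i) yh. Qed.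

Lemma young_tperm (i j : 'I_(m + n)) : (i < m)%N = (j < m)%N -> young (tperm i j).
Proof. by move=> ij; apply/youngP => k; case: tpermP => [->|->|]. Qed.

(** Exchanging the adjacent values i and i + 1 affects the relative order of
no other pair of positions. *)
Lemma perm_length_adjacent N (g : 'S_N) (i j : 'I_N) :
  j = i.+1 :> nat -> (g^-1%g j < g^-1%g i)%N ->
  (perm_length (g * tperm i j)%g < perm_length g)%N.
Proof.
move=> ji lt_V; have lt_ij : (i < j)%N by rewrite ji.
apply/proper_card/properP; split; last first.
  exists (g^-1%g j, g^-1%g i); rewrite inE /= ?permM !permKV lt_V //.
  by rewrite tpermL tpermR -leqNgt ltnW.
apply/subsetP => -[a c]; rewrite !inE /= !permM => /andP[lt_ac].
rewrite lt_ac /=; have ne : g a != g c by rewrite (inj_eq perm_inj) lt_neq.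
case: tpermP => [gc|gc|/eqP nic /eqP njc]; case: tpermP => [ga|ga|/eqP nia /eqP nja].
- by rewrite ltnn.
- by rewrite ltnNge ltnW.
- by rewrite gc; apply: ltn_trans.
- by move: lt_V; rewrite -ga -gc !permK ltnNge ltnW.
- by rewrite ltnn.
- by move=> lt; rewrite gc ltn_neqAle ji lt -ji andbT eq_sym.
- by rewrite ga ji ltnS leq_eqVlt => /orP[/eqP/val_inj/eqP|//]; rewrite (negPf nic).
- by rewrite ga => lt; apply: ltn_trans lt lt_ij.
- by [].
Qed.

(** Otherwise two adjacent values in the same block would be in the wrong
order, and exchanging them would give a shorter element of the coset. *)
Lemma shortest_increasing g (i j : 'I_(m + n)) : shortest g ->
  (i < j)%N -> (i < m)%N = (j < m)%N -> (g^-1%g i < g^-1%g j)%N.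
Proof.
move=> /forallP sg; have adj (x y : 'I_(m + n)) : y = x.+1 :> nat ->
    (x < m)%N = (y < m)%N -> (g^-1%g x < g^-1%g y)%N.
  move=> yx xy; rewrite ord_ltnNge ?(inj_eq perm_inj); last first.
    by rewrite lt_neq // yx.
  apply/negP => /(perm_length_adjacent yx); rewrite ltnNge.
  by have := sg (tperm x y); rewrite young_tperm //= => ->.
have [k] := ubnP (j - i)%N; elim: k i j => // k IHk i j lek lt_ij ij.
have lt_i1 : (i.+1 < m + n)%N := leq_ltn_trans lt_ij (ltn_ord j).
pose i' := Ordinal lt_i1.
have ii' : (i < m)%N = (i' < m)%N.
  apply/idP/idP => [im|/= /ltnW//]; apply: leq_ltn_trans (lt_ij) _.
  by rewrite -ij.
have lt1 := adj i i' erefl ii'.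
have [/val_inj <-//|lt_i'j] := eqVneq (i' : nat) j.
apply: ltn_trans lt1 (IHk i' j _ _ _); last by rewrite -ii'.
  by rewrite /= subnS prednK ?subn_gt0 // -ltnS.
by rewrite ltn_neqAle lt_i'j.
Qed.

(** The inverses of g and g * h are both increasing on the blocks, hence so is
that of h; as h preserves the blocks, its inverse is increasing everywhere. *)
Lemma shortest_uniq g h : shortest g -> young h -> shortest (g * h)%g -> h = 1%g.
Proof.
move=> sg yh sgh; apply: invg_inj; rewrite invg1.
have /youngP yV := youngV yh.
apply: perm_increasing => i j lt_ij.
have [ij|ij] := eqVneq (i < m)%N (j < m)%N; last first.
  have [im jm] : (i < m)%N /\ (m <= j)%N.
    move: ij; have [im|im] := ltnP i m; have [jm|jm] := ltnP j m => // _.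
    by have := leq_ltn_trans im (ltn_trans lt_ij jm); rewrite ltnn.
  by apply: (@leq_trans m); [rewrite yV | rewrite leqNgt yV -leqNgt].
rewrite ord_ltnNge ?(inj_eq perm_inj) ?lt_neq //; apply/negP => lt_ji.
have /(shortest_increasing sg lt_ji) : (h^-1%g j < m)%N = (h^-1%g i < m)%N.
  by rewrite !yV.
have := shortest_increasing sgh lt_ij ij; rewrite invMg !permM ltnNge.
by move=> /negP le /ltnW.
Qed.

Lemma shortest_exists g : exists2 h, young h & shortest (g * h)%g.
Proof.
case: (@arg_minnP _ 1%g (@young m n) (fun h => perm_length (g * h)%g) young1) => h yh hmin.
exists h => //; apply/forallP => h'; apply/implyP => yh'.
by rewrite -mulgA hmin // youngM.
Qed.

(** Each coset of the Young subgroup contains exactly one shortest element. *)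
Lemma sum_shortest (W : zmodType) (F : 'S_(m + n) -> W) :
  (forall g h, young h -> F (g * h)%g = F g) ->
  \sum_g F g = (\sum_(g | shortest g) F g) *+ #|[pred h | @young m n h]|.
Proof.
move=> FY; transitivity (\sum_(g : 'S_(m + n)) \sum_(h | young h && shortest (g * h)%g) F g).
  apply: eq_bigr => g _; have [h yh sgh] := shortest_exists g.
  rewrite (bigD1 h) ?yh //= big1 ?addr0 // => h' /andP[/andP[yh' sgh'] ne].
  case/eqP: ne; apply: (mulgI h^-1%g); rewrite mulVg.
  by apply: (shortest_uniq sgh); rewrite ?youngM ?youngV // mulgA mulgK.
under eq_bigr do rewrite big_mkcondr.
rewrite exchange_big /= -sumr_const; apply: eq_bigr => h yh.
rewrite [RHS]big_mkcond [RHS](reindex_inj (mulIg h)); apply: eq_bigr => g _ /=.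
by rewrite FY.
Qed.

Definition young_fun (g1 : 'S_m) (g2 : 'S_n) (i : 'I_(m + n)) : 'I_(m + n) :=
  match split i with inl a => lshift n (g1 a) | inr b => rshift m (g2 b) end.

Lemma young_funL (g1 : 'S_m) (g2 : 'S_n) a : young_fun g1 g2 (lshift n a) = lshift n (g1 a).
Proof. by rewrite /young_fun (unsplitK (inl a)). Qed.
Lemma young_funR (g1 : 'S_m) (g2 : 'S_n) b : young_fun g1 g2 (rshift m b) = rshift m (g2 b).
Proof. by rewrite /young_fun (unsplitK (inr b)). Qed.

Lemma young_fun_can (g1 : 'S_m) (g2 : 'S_n) : cancel (young_fun g1 g2) (young_fun g1^-1 g2^-1).
Proof.
by move=> i; rewrite -(splitK i); case: (split i) => a /=;
  rewrite ?(young_funL, young_funR) permK.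
Qed.

Definition young_perm (g1 : 'S_m) (g2 : 'S_n) : 'S_(m + n) := perm (can_inj (young_fun_can g1 g2)).

Lemma young_permL (g1 : 'S_m) (g2 : 'S_n) a : young_perm g1 g2 (lshift n a) = lshift n (g1 a).
Proof. by rewrite permE young_funL. Qed.
Lemma young_permR (g1 : 'S_m) (g2 : 'S_n) b : young_perm g1 g2 (rshift m b) = rshift m (g2 b).
Proof. by rewrite permE young_funR. Qed.

Lemma young_permV (g1 : 'S_m) (g2 : 'S_n) : (young_perm g1 g2)^-1%g = young_perm g1^-1 g2^-1.
Proof.
apply/permP => i; apply: (@perm_inj _ (young_perm g1 g2)); rewrite permKV.
by rewrite !permE -{1}[g1]invgK -{1}[g2]invgK young_fun_can.
Qed.

Lemma young_young_perm (g1 : 'S_m) (g2 : 'S_n) : young (young_perm g1 g2).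
Proof.
apply/youngP => i; rewrite -(splitK i); case: (split i) => a /=.
  by rewrite young_permL /= !ltn_ord.
by rewrite young_permR /= !ltnNge !leq_addr.
Qed.

Lemma young_perm_inj (g1 : 'S_m) (g2 : 'S_n) (g1' : 'S_m) (g2' : 'S_n) :
  young_perm g1 g2 = young_perm g1' g2' -> g1 = g1' /\ g2 = g2'.
Proof.
move=> /permP E; split; apply/permP => a.
  by have := E (lshift n a); rewrite !young_permL => /lshift_inj.
by have := E (rshift m a); rewrite !young_permR => /rshift_inj.
Qed.

Lemma young_permP h : young h -> exists k : 'S_m * 'S_n, h = young_perm k.1 k.2.
Proof.
move=> yh; have /youngP hm := yh.
pose f1 a := if split (h (lshift n a)) is inl b then b else a.
pose f2 a := if split (h (rshift m a)) is inr b then b else a.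
have f1E a : lshift n (f1 a) = h (lshift n a).
  rewrite /f1; case: splitP => [b hb|b hb]; first by apply/val_inj.
  by have := hm (lshift n a); rewrite hb /= ltn_ord ltnNge leq_addr.
have f2E a : rshift m (f2 a) = h (rshift m a).
  rewrite /f2; case: splitP => [b hb|b hb]; last by apply/val_inj.
  by have := hm (rshift m a); rewrite hb /= ltn_ord ltnNge leq_addr.
have f1I : injective f1.
  by move=> a b E; apply: (@lshift_inj m n); apply: (@perm_inj _ h); rewrite -!f1E E.
have f2I : injective f2.
  by move=> a b E; apply: (@rshift_inj m n); apply: (@perm_inj _ h); rewrite -!f2E E.
exists (perm f1I, perm f2I); apply/permP => i; rewrite -(splitK i).
by case: (split i) => a /=; rewrite ?(young_permL, young_permR) permE.
Qed.

Lemma card_young : #|[pred h | @young m n h]| = (m`! * n`!)%N.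
Proof.
rewrite -(card_Sn m) -(card_Sn n) -card_prod.
rewrite -(card_codom (f := fun g : 'S_m * 'S_n => young_perm g.1 g.2)); last first.
  by move=> [a b] [a' b'] /young_perm_inj /= [-> ->].
apply: eq_card => h; rewrite inE; apply/idP/codomP => [/young_permP//|[g ->]].
exact: young_young_perm.
Qed.

End Young.

(** * Shuffle and star products as induced tensors *)

Section YoungAction.
Variables (O : comNzRingType) (V : supermodule O) (m n : nat).

Lemma actsgn_young (g1 : 'S_m) (g2 : 'S_n) p :
  actsgn O (young_perm g1 g2) p =
  actsgn O g1 (fun a => p (lshift n a)) * actsgn O g2 (fun b => p (rshift m b)).
Proof.
rewrite !actsgnE young_permV big_split_ord /=; congr (_ * _); apply: eq_bigr => a _.
  rewrite big_split_ord /= [X in _ * X]big1 => [|b _].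
    rewrite mulr1; apply: eq_bigr => c _; by rewrite !young_permL.
  by rewrite young_permL young_permR /= ltnNge ltnW ?ltn_addr.
rewrite big_split_ord /= [X in X * _]big1 => [|c]; last first.
  by rewrite ltnNge ltnW // ltn_addr.
rewrite mul1r; apply: eq_big => [c|c _]; first by rewrite ltn_add2l.
by rewrite !young_permR /= ltn_add2l.
Qed.

Definition lword (w : word V (m + n)) : word V m := [ffun a => w (lshift n a)].
Definition rword (w : word V (m + n)) : word V n := [ffun b => w (rshift m b)].

Lemma tprodE (s : tensor V m) (t : tensor V n) w :
  tprod s t w = (s (lword w) : O) * t (rword w) :> O.
Proof. by rewrite ffunE. Qed.

Lemma tact_young s t (g1 : 'S_m) (g2 : 'S_n) :
  tact (tprod s t) (young_perm g1 g2) = tprod (tact (V := V) s g1) (tact t g2).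
Proof.
apply/ffunP => w; rewrite tactE !tprodE !tactE actsgn_young mulrACA young_permV.
have -> : lword (wperm w (young_perm g1^-1 g2^-1)) = wperm (lword w) g1^-1.
  by apply/ffunP => a; rewrite !ffunE young_permL.
have -> : rword (wperm w (young_perm g1^-1 g2^-1)) = wperm (rword w) g2^-1.
  by apply/ffunP => a; rewrite !ffunE young_permR.
congr (_ * _ * (_ * _)); apply: actsgn_ext => a; rewrite /= !ffunE.
  by rewrite young_permL.
by rewrite young_permR.
Qed.

Lemma tprod_linearl (t : tensor V n) : linear (fun s : tensor V m => tprod s t).
Proof.
by move=> c x y; apply/ffunP => w; rewrite tensor_linE !tprodE tensor_linE mulrDl mulrA.
Qed.

Lemma tprod_linearr (s : tensor V m) : linear (tprod (n := n) s).
Proof.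
by move=> c x y; apply/ffunP => w; rewrite tensor_linE !tprodE tensor_linE mulrDr mulrCA.
Qed.

Lemma shuffle_linearr (s : tensor V m) : linear (shuffle (n := n) s).
Proof.
move=> c x y; rewrite scaler_sumr -big_split; apply: eq_bigr => g _ /=.
by rewrite tprod_linearr tact_linear.
Qed.

Lemma sum_young s t : \sum_(h | @young m n h) tact (tprod s t) h =
  tprod (sym s) (sym t) :> tensor V (m + n).
Proof.
have [_ _ _ Sl] := lin_props (tprod_linearl (sym t)).
rewrite {1}/sym Sl; under [RHS]eq_bigr => g1 _.
  have [_ _ _ Sr] := lin_props (tprod_linearr (tact s g1)).
  by rewrite /sym Sr; over.
rewrite pair_bigA /= (reindex (fun k : 'S_m * 'S_n => young_perm k.1 k.2)) /=; last first.
  have inj : injective (fun k : 'S_m * 'S_n => young_perm k.1 k.2).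
    by move=> [a b] [a' b'] /young_perm_inj /= [-> ->].
  exists (fun h => odflt (1%g, 1%g) [pick k | h == young_perm k.1 k.2]) => [k _|h yh].
    case: pickP => [k' /eqP /inj ->//|/(_ k)]; by rewrite eqxx.
  have [k ->] := young_permP yh.
  by case: pickP => [k' /eqP <-//|/(_ k)]; rewrite eqxx.
by apply: eq_big => [k|k _]; [rewrite young_young_perm | rewrite tact_young].
Qed.

(** For invariant s and t the translates of their product are constant on the
cosets of the Young subgroup, of which the shuffle product takes one
representative each. *)
Lemma shuffle_sym (s : tensor V m) (t : tensor V n) : fixed setT s -> fixed setT t ->
  (m`! * n`!)%:R *: shuffle s t = sym (tprod s t).
Proof.
move=> fs ft; rewrite /sym sum_shortest => [|g h yh].
  by rewrite -card_young scaler_nat.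
have [[h1 h2] ->] := young_permP yh.
by rewrite -tactM tact_young fs ?inE // ft ?inE.
Qed.

Lemma sym_tprod_sym (s : tensor V m) (t : tensor V n) :
  sym (tprod (sym s) (sym t)) = (m`! * n`!)%:R *: sym (tprod s t).
Proof.
rewrite -sum_young sym_sum (eq_bigr (fun=> sym (tprod s t))) => [|h _].
  by rewrite -card_young scaler_nat -sumr_const.
exact: sym_tact.
Qed.

End YoungAction.

Section ShuffleStar.
Variables (O : idomainType) (V : supermodule O).
Hypothesis charO : forall n, (0 < n)%N -> n%:R != 0 :> O.

Lemma fixed_sym d (t : tensor V d) : fixed setT (sym t).
Proof. by move=> g _; apply: tact_sym. Qed.

Lemma sym_fixed d (t : tensor V d) : fixed setT t -> sym t = d`!%:R *: t.
Proof. by move=> ft; have [_ <-] := ind_setT ft; rewrite cardsT card_Sn. Qed.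

Lemma fixed_tensor1 (t : tensor V 1) : fixed setT t.
Proof.
move=> g _; have -> : g = 1%g by apply/permP => i; rewrite !ord1.
exact: tact1.
Qed.

Lemma shuffle_sym_sym m n (s : tensor V m) (t : tensor V n) :
  shuffle (sym s) (sym t) = sym (tprod s t).
Proof.
apply: (tensor_scaleI charO (n := m`! * n`!)); first by rewrite muln_gt0 !fact_gt0.
by rewrite shuffle_sym ?sym_tprod_sym //; apply: fixed_sym.
Qed.

(** In degree one every tensor is invariant and equal to its symmetrization,
so the recursive definition iterates [shuffle_sym_sym]. *)
Lemma star_sym e (v : 'I_e -> V) : star v = sym (pure v).
Proof.
elim: e v => [|e IHe] v.
  rewrite sym_fixed ?scale1r // => g _; have -> : g = 1%g by apply/permP => -[].
  exact: tact1.
rewrite /= IHe -[X in shuffle X _]scale1r -(sym_fixed (fixed_tensor1 _)).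
rewrite shuffle_sym_sym tprod_pure; congr sym.
apply: (pure_multilinear V e.+1).1 => i; case: splitP => j ij; congr v.
  by apply/val_inj; rewrite /= ij ord1.
by apply/val_inj; rewrite /= ij.
Qed.

(** The shuffle product is the tensor induced from S_m, of order m!, and from
the product of s and t: the factor n! of the Young subgroup is absorbed by the
symmetrization of t. *)
Lemma shuffle_fixed_sym m n (s : tensor V m) (t : tensor V n) : fixed setT s ->
  m`!%:R *: shuffle s (sym t) = sym (tprod s t).
Proof.
move=> fs; apply: (tensor_scaleI charO (n := m`! * n`!)).
  by rewrite muln_gt0 !fact_gt0.
rewrite -sym_tprod_sym (sym_fixed fs) scalerA mulrC -scalerA.
rewrite shuffle_sym //; last exact: fixed_sym.
have [_ _ -> _] := lin_props (tprod_linearl (m := m) (sym t)).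
by rewrite symZ.
Qed.

End ShuffleStar.

Section Spread.
Variables (O : idomainType) (A : superalgebra O).
Hypothesis charO : forall n, (0 < n)%N -> n%:R != 0 :> O.

Lemma sym_spot d (b : 'I_d) (y : A) e : hom e y ->
  sym (spot b y) = (d.-1)`!%:R *: spread d y.
Proof.
move=> hy; have d0 : (0 < d)%N := leq_ltn_trans (leq0n b) (ltn_ord b).
apply: (tensor_scaleI charO d0); rewrite scalerA -natrM.
have -> : (d * (d.-1)`!)%N = d`! by case: (d) d0.
rewrite -(sym_fixed (fixed_spread hy)) sym_sum (eq_bigr (fun=> sym (spot b y))).
  by rewrite sumr_const card_ord scaler_nat.
move=> c _; rewrite -(sym_tact (spot c y) (tperm b c)).
by rewrite -(tact_spot b (tperm b c) hy) tpermL.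
Qed.

(** After multiplication by m!, both sides are the sum of all translates of
1 (x) ... (x) 1 (x) y: each position of y is reached by m! permutations. *)
Lemma spread_shuffle m (y : A) :
  shuffle (pure (fun _ : 'I_m => sone)) (pure (fun _ : 'I_1 => y)) = spread (m + 1) y.
Proof.
have l1 : linear (fun y : A => shuffle (pure (fun _ : 'I_m => sone : A)) (pure (fun _ : 'I_1 => y))).
  have E (x : A) : pure (fun _ : 'I_1 => x) = pure (fun i => if i == ord0 then x else 0).
    by apply: (pure_multilinear A 1).1 => i; rewrite ord1.
  by move=> c x z; rewrite -shuffle_linearr !E (pure_multilinear A 1).2.
have [_ _ Z1 S1] := lin_props l1; have [_ _ Z2 S2] := lin_props (@spread_linear O A (m + 1)).
rewrite (bas_sum y) S1 S2; apply: eq_bigr => i _; rewrite Z1 Z2; congr (_ *: _).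
apply: (tensor_scaleI charO (fact_gt0 m)).
have one_fixed : fixed setT (pure (fun _ : 'I_m => sone : A)).
  move=> g _; rewrite (tact_pure_hom _ (fun=> sone_hom A)).
  by rewrite (@actsgn_even _ _ _ _ setT) ?scale1r //; apply/subsetP => a; rewrite inE.
rewrite -[X in shuffle _ X]scale1r -(sym_fixed (fixed_tensor1 _)).
rewrite shuffle_fixed_sym // tprod_pure.
have <- : spot (rshift m ord0) (bas i) = pure (fun j : 'I_(m + 1) =>
    match split j with inl _ => sone | inr _ => bas i end).
  apply: (pure_multilinear A _).1 => j; rewrite -(splitK j).
  case: (split j) => c /=; first by rewrite (unsplitK (inl c)) eq_lrshift.
  by rewrite (unsplitK (inr c)) ord1 eqxx.
by rewrite (sym_spot _ (bas_hom i)) addn1.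
Qed.

End Spread.

(** * The Turner double as a span of induced tensors *)

(** The lists of the elements of A and of B, each followed by the elements
outside, are matched. *)
Lemma perm_set_exists (T : finType) (A B : {set T}) : #|A| = #|B| ->
  exists h : {perm T}, forall x, (h x \in B) = (x \in A).
Proof.
move=> cAB; pose l (C : {set T}) := enum C ++ enum (~: C).
have memE C x : x \in l C by rewrite mem_cat !mem_enum inE orbN.
have uniqE C : uniq (l C).
  rewrite cat_uniq !enum_uniq andbT /=; apply/hasPn => x.
  by rewrite !mem_enum inE.
have sizeE C : size (l C) = #|T| by rewrite size_cat -!cardE cardsC.
pose h x := nth x (l B) (index x (l A)).
have ltE x : (index x (l A) < size (l B))%N by rewrite sizeE -(sizeE A) index_mem.
have hI : injective h.
  move=> x y; rewrite /h (set_nth_default x y (ltE y)) => /eqP.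
  rewrite nth_uniq // => /eqP E.
  by rewrite -(nth_index x (memE A x)) E nth_index.
exists (perm hI) => x; rewrite permE /h nth_cat -cardE -cAB cardE.
rewrite index_cat mem_enum; have [xA|xA] := boolP (x \in A).
  by rewrite index_mem mem_enum xA -mem_enum mem_nth // -cardE -cAB cardE index_mem mem_enum.
rewrite ltnNge leq_addr addKn /=; apply: negbTE; rewrite -in_setC -mem_enum.
have cC : #|~: A| = #|~: B| by apply/eqP; rewrite -(eqn_add2l #|A|) {2}cAB !cardsC.
apply: mem_nth; rewrite -cardE -cC cardE.
by rewrite index_mem mem_enum inE.
Qed.

Lemma split_lshift m n (a : 'I_m) : split (lshift n a) = inl a.
Proof. exact: (unsplitK (inl a)). Qed.

Lemma split_rshift m n (b : 'I_n) : split (rshift m b) = inr b.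
Proof. exact: (unsplitK (inr b)). Qed.

Section TurnerDouble.
Variables (O : idomainType) (X : superalgebra O).
Hypothesis charO : forall n, (0 < n)%N -> n%:R != 0 :> O.
Local Notation T := (T_alg X).

Definition X_letters : {set idx T} :=
  [set i : idx X + idx X | if i is inl _ then true else false].

Lemma lets_X (x : T) : lets X_letters x <-> in_X x.
Proof.
split=> [Lx|x0].
  rewrite /in_X (dual_sum x.2) big1 // => i _.
  have := Lx (inr i); rewrite inE => /(_ isT); rewrite [dbas _ _](T_dbasE _ x) => ->.
  exact: scale0r.
by case=> i; rewrite inE // => _; rewrite [LHS](T_dbasE _ x) x0 zero_lfunE.
Qed.

Lemma lets_dual (x : T) : lets (~: X_letters) x <-> in_dual x.
Proof.
split=> [Lx|x0].
  rewrite /in_dual (bas_sum x.1) big1 // => i _.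
  have := Lx (inl i); rewrite !inE => /(_ isT); rewrite [dbas _ _](T_dbasE _ x) => ->.
  exact: scale0r.
by case=> i; rewrite !inE // => _; rewrite [LHS](T_dbasE _ x) x0 linear0.
Qed.

Lemma lets_X0 (x : T) : lets [set i in X_letters | ~~ par i] x <-> in_X0 x.
Proof.
split=> [Lx|[hx x0] i].
  split; last by apply/lets_X => i iX; apply: Lx; rewrite inE (negPf iX).
  move=> i; case pi: (par i) => // _; apply: etrans (esym (T_dbasE (inl i) x)) _.
  by apply: (Lx (inl i)); rewrite !inE /= pi.
rewrite inE negb_and => /orP[iX|]; first by have /lets_X := x0; apply.
rewrite negbK; case: i => i pi; rewrite [LHS](T_dbasE _ x) ?x0 ?zero_lfunE //.
by apply: hx; have -> : par i := pi.
Qed.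

Lemma tpowP d (P : T -> Prop) L (t : tensor T d) : (forall x, lets L x <-> P x) ->
  tpow P t <-> slots (fun=> lets L) t.
Proof.
move=> LP; split; last first.
  apply: lspan_ind => [|_ [v [p [vP ->]]]]; first exact: lspan_submod.
  by apply: lspan_gen; exists v => // a; apply/LP/(vP a).2.
apply: lspan_ind => [|_ [v vP ->]]; first exact: slots_submod.
apply/slots_letsP => w; rewrite ffunE => nz a; apply: contraNT nz => waL.
by rewrite (bigD1 a) //=; have /LP -> := vP a; rewrite ?mul0r.
Qed.

Lemma InvP d (P : T -> Prop) L (t : tensor T d) : (forall x, lets L x <-> P x) ->
  Inv P t <-> slots (fun=> lets L) t /\ fixed setT t.
Proof.
move=> LP; split=> [[/(tpowP _ LP) Lt ft]|[/(tpowP _ LP) Lt ft]]; split=> // g.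
by apply: ft; rewrite inE.
Qed.

Definition left_slots m n : {set 'I_(m + n)} := [set lshift n a | a : 'I_m].

Lemma card_left_slots m n : #|left_slots m n| = m.
Proof. by rewrite card_imset ?card_ord //; apply: lshift_inj. Qed.

Lemma mem_left_slots m n (i : 'I_(m + n)) : (i \in left_slots m n) = (i < m)%N.
Proof.
apply/imsetP/idP => [[a _ ->]|im]; first exact: (ltn_ord a).
by exists (Ordinal im) => //; apply/val_inj.
Qed.

Lemma Sym_left_slots m n (g : 'S_(m + n)) :
  g \in Sym (left_slots m n) -> exists g1, g = young_perm g1 1%g.
Proof.
rewrite inE => gJ; have /young_permP[[g1 g2] gE] : young g.
  by apply/youngP => i; rewrite -!mem_left_slots perm_closed.
exists g1; rewrite gE; congr young_perm; apply/permP => b; rewrite perm1.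
apply: (@rshift_inj m n); rewrite -(young_permR g1) -gE (out_perm gJ) //.
by rewrite mem_left_slots /= ltnNge leq_addr.
Qed.

Lemma young_perm_left m n (g1 : 'S_m) :
  young_perm g1 (1%g : 'S_n) \in Sym (left_slots m n).
Proof.
rewrite inE; apply/subsetP => i; rewrite -(splitK i) inE.
case: (split i) => a /=; last by rewrite young_permR perm1 eqxx.
by rewrite mem_left_slots /= ltn_ord.
Qed.

Lemma induced_tcast m d (E : m = d) L (t : tensor T m) :
  induced L t -> induced L (tcast E t).
Proof. by case: d / E. Qed.

Lemma turner_induced d (t : tensor T d) : turner_double t -> induced X_letters t.
Proof.
move: t; apply: lspan_ind => [|_ [e [le_ed [p [q [pI qS ->]]]]]].
  exact: induced_submod.
apply: induced_tcast; move: (d - e)%N p pI => m p /(InvP _ lets_X)[Lp fp].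
move: q qS; apply: (lspan_ind (P := fun q => induced _ (shuffle p q))).
  exact: submod_preim (shuffle_linearr p) (@induced_submod _ _ _ X_letters).
move=> _ [v vP ->]; rewrite (star_sym charO).
apply: (@induced_gen _ _ _ _ (left_slots m e) (Sym (left_slots m e))%G
  (tprod p (pure v))); first exact: subxx.
  apply/slots_lets_onP => w; rewrite tprodE mulf_eq0 negb_or => /andP[nz _] a /imsetP[b _ ->].
  by have := proj1 (slots_letsP _ _) Lp _ nz b; rewrite ffunE.
split; last by rewrite card_Sym card_left_slots (shuffle_fixed_sym charO).
by move=> g /Sym_left_slots[g1 ->]; rewrite tact_young fp ?inE // tact1.
Qed.

Lemma turner_shuffle m e d (E : (m + e)%N = d) (p : tensor T m) (q : tensor T e) :
  Inv (@in_X O X) p -> Star (@in_dual O X) q -> turner_double (tcast E (shuffle p q)).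
Proof.
move=> pI qS; case: d / E; apply: lspan_gen.
have Em : m = (m + e - e)%N by rewrite addnK.
exists e, (leq_addl m e), (tcast Em p), q; move: (subnK _).
case: _ / Em => E; split=> //.
by rewrite (eq_irrelevance E erefl).
Qed.

(** The letters allowed at the position a while [induced_turner] decides, one
position after the other, whether a letter outside J lies in X^*. *)
Definition off_dual d (J N : {set 'I_d}) (a : 'I_d) : {set idx T} :=
  if a \in J then X_letters else if a \in N then ~: X_letters else setT.

(** The tensor is sorted by the word u in its last e positions; the
coefficient p u of this word is an invariant tensor over X, and by assumption
only words u in the letters of X^* occur. *)
Lemma turner_left_slots m e d (E : (m + e)%N = d) (s t : tensor T (m + e)) :
  fixed (Sym (left_slots m e)) s ->
  slots (fun a => lets (off_dual (left_slots m e) setT a)) s ->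
  m`!%:R *: t = sym s -> turner_double (tcast E t).
Proof.
move=> fs Ls st.
pose join (w : word T m) (u : word T e) : word T (m + e) :=
  [ffun i => match split i with inl a => w a | inr b => u b end].
have joinK (w : word T (m + e)) : join (lword w) (rword w) = w.
  apply/ffunP => i; rewrite ffunE -{2}(splitK i).
  by case: (split i) => a; rewrite ffunE.
have ljoin w u : lword (join w u) = w.
  by apply/ffunP => a; rewrite !ffunE split_lshift.
have rjoin w u : rword (join w u) = u.
  by apply/ffunP => a; rewrite !ffunE split_rshift.
pose p u : tensor T m := [ffun w => s (join w u)].
pose good (u : word T e) := [forall b, u b \notin X_letters].
have sE : s = \sum_(u | good u) tprod (p u) (bast u).
  apply/ffunP => w; rewrite sum_ffunE.
  have term u : tprod (p u) (bast u) w = if u == rword w then s w else 0.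
    rewrite tprodE bastE ffunE eq_sym; case: eqP => [->|_]; last by rewrite mulr0.
    by rewrite joinK mulr1.
  under eq_bigr do rewrite term.
  have [gw|/forallPn[b bX]] := boolP (good (rword w)).
    by rewrite (bigD1 (rword w)) //= eqxx big1 ?addr0 // => u /andP[_ /negPf ->].
  have sw : s w = 0.
    apply/eqP; apply: contraR bX => nz.
    have := proj1 (slots_letsP _ _) Ls w nz (rshift m b).
    by rewrite /off_dual mem_left_slots /= ltnNge leq_addr inE ffunE in_setC.
  by rewrite sw big1 // => u _; case: eqP.
have fp u : fixed setT (p u).
  move=> g1 _; apply/ffunP => w; rewrite ffunE -(fs _ (young_perm_left e g1)).
  rewrite !tactE actsgn_young young_permV [_ 1%g _](@actsgn_even _ _ _ _ set0) ?invg1.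
  - rewrite mulr1; have -> : wperm (join w u) (young_perm g1^-1 1%g) = join (wperm w g1^-1) u.
      apply/ffunP => i; rewrite -(splitK i); case: (split i) => a /=; rewrite !ffunE.
        by rewrite young_permL !split_lshift ffunE.
      by rewrite young_permR !split_rshift perm1.
    rewrite ffunE; congr (_ * _); apply: actsgn_ext => a /=.
    by rewrite [in RHS]ffunE split_lshift.
  - by move=> a; rewrite inE.
  - exact: perm_on1.
have Lp u : slots (fun=> lets X_letters) (p u).
  apply/slots_letsP => w; rewrite ffunE => nz a.
  have := proj1 (slots_letsP _ _) Ls _ nz (lshift e a).
  by rewrite /off_dual mem_left_slots /= ltn_ord ffunE split_lshift.
have -> : t = \sum_(u | good u) shuffle (p u) (sym (bast u)).
  apply: (tensor_scaleI charO (fact_gt0 m)); rewrite st {1}sE sym_sum scaler_sumr.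
  by apply: eq_bigr => u _; rewrite (shuffle_fixed_sym charO).
case: d / E; apply: submod_sum => [|u /forallP gu]; first exact: lspan_submod.
apply: (@turner_shuffle m e _ erefl); first by apply/(InvP _ lets_X).
rewrite -(star_sym charO); apply: lspan_gen; exists (fun b => bas (u b)) => // b.
by apply/lets_dual/lets_bas; rewrite in_setC.
Qed.

(** A permutation that carries J to the first positions reduces to
[turner_left_slots]. *)
Lemma turner_off_dual d (J : {set 'I_d}) (s t : tensor T d) :
  fixed (Sym J) s -> slots (fun a => lets (off_dual J setT a)) s ->
  #|Sym J|%:R *: t = sym s -> turner_double t.
Proof.
have E : (#|J| + #|~: J|)%N = d by rewrite cardsC card_ord.
move: {2}#|J| (erefl #|J|) E => m Jm; move: #|~: J| => e E.
rewrite Jm in E; case: d / E J Jm s t => J Jm s t fs Ls.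
rewrite card_Sym Jm => st.
have [h hJ] : exists h : 'S_(m + e), forall i, (h i \in J) = (i \in left_slots m e).
  by apply: perm_set_exists; rewrite card_left_slots.
apply: (@turner_left_slots m e _ erefl (tact s h)); last by rewrite sym_tact.
  move=> g; rewrite inE => gJ; rewrite tactM.
  have -> : (g * h = h * g ^ h)%g by rewrite conjgE mulKVg.
  rewrite -tactM fs // inE; apply/subsetP => i; rewrite inE; apply: contraNT => iJ.
  rewrite conjgE !permM (out_perm gJ) ?permKV //.
  by rewrite -hJ permKV.
by apply: slots_tact Ls => a x; rewrite /off_dual hJ !in_setT.
Qed.

(** Let N be the set of positions outside J known to carry letters of X^*. At a
position a in neither set, the tensor is the sum of a part with letters of X at
a, where a is added to J by induction in stages, and of a part with letters of X^*
at a, where a is added to N. *)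
Lemma induced_turner d (t : tensor T d) : induced X_letters t -> turner_double t.
Proof.
suff main k : forall (J N : {set 'I_d}) (H : {group 'S_d}) s u,
    (#|~: (J :|: N)| <= k)%N -> H \subset Sym J ->
    slots (fun a => lets (off_dual J N a)) s -> ind H s u -> turner_double u.
  move: t; apply: lspan_ind => [|t [J [H [s [HJ Ls st]]]]]; first exact: lspan_submod.
  apply: (main _ J set0 H s t (leqnn _) HJ) => //; apply: slots_sub Ls => a x Lx.
  by rewrite /off_dual inE; case: ifP => [/Lx//|_ i]; rewrite inE.
elim: k => [|k IHk] J N H s0 u lek HJ Ls0 st0.
  have [s' st' Ps'] := ind_trans charO HJ st0.
  have JN a : a \in J :|: N.
    by move: lek; rewrite leqn0 cards_eq0 => /eqP/setP/(_ a); rewrite in_setC in_set0 => /negbFE.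
  apply: (@turner_off_dual _ J s'); [exact: st'.1| |exact: st'.2].
  apply: Ps' => [|g]; first exact: slots_submod.
  rewrite inE => gJ; apply: slots_tact Ls0 => a x; rewrite /off_dual perm_closed // in_setT.
  case: ifP => // aJ; have := JN a; rewrite inE aJ (out_perm gJ) ?aJ //.
  by move=> /= ->.
have [JN|/set0Pn[a]] := eqVneq (~: (J :|: N)) set0.
  by apply: (IHk J N H s0 u _ HJ Ls0 st0); rewrite JN cards0.
rewrite in_setC in_setU negb_or => /andP[aJ aN].
have [s st Ps'] := ind_trans charO HJ st0.
have Ls : slots (fun a => lets (off_dual J N a)) s.
  apply: Ps' => [|g]; first exact: slots_submod.
  rewrite inE => gJ; apply: slots_tact Ls0 => b x; rewrite /off_dual perm_closed //.
  by case: ifP => // /negbT bJ; rewrite (out_perm gJ).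
pose r (e : bool) := restrict (fun w : word T d => (w a \in X_letters) == e) s.
have fr e : fixed (Sym J)%G (r e).
  move=> g gJ; rewrite tact_restrict (st.1 g gJ); apply: restrict_ext => w.
  by rewrite ffunE (out_perm (perm_onV _) aJ) //; rewrite inE in gJ.
have [u1 st1] := ind_exists charO (fr true).
have [u0 st0'] := ind_exists charO (fr false).
have -> : u = u1 + u0.
  apply: (ind_uniq charO st); have -> : s = r true + r false; last exact: ind_add.
  apply/ffunP => w; rewrite tensorDE !restrictE.
  by case: (_ \in _); rewrite /= ?addr0 ?add0r.
have small J' N' : a \in J' :|: N' -> J :|: N \subset J' :|: N' ->
    (#|~: (J' :|: N')| <= k)%N.
  move=> aJN sub; rewrite -ltnS; apply: leq_trans lek; apply: proper_card.
  apply/properP; split; first by rewrite setCS.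
  by exists a; rewrite in_setC ?negbK // in_setU negb_or aJ.
have Lr e : forall w, r e w != 0 -> ((w a \in X_letters) == e) /\
    forall b, w b \in off_dual J N b.
  move=> w; rewrite restrictE; case: ifP => [we nz|]; last by rewrite eqxx.
  by split=> // b; apply: (proj1 (slots_letsP _ _) Ls w nz).
apply: submodD; first exact: lspan_submod.
  apply: (IHk (a |: J) N (Sym J)%G (r true) _ _ _ _ st1).
  - by apply: small; rewrite -setUA ?setU11 // subsetUr.
  - exact/sub_Sym/subsetUr.
  apply/slots_letsP => w /Lr[/eqP wa Lw] b.
  have := Lw b; rewrite /off_dual in_setU1; case: eqVneq => [->|//].
  by rewrite wa.
apply: (IHk J (a |: N) (Sym J)%G (r false) _ _ _ _ st0').
- by apply: small; rewrite ?inE ?eqxx ?orbT // setUS // subsetUr.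
- exact: subxx.
apply/slots_letsP => w /Lr[/eqP wa Lw] b.
have := Lw b; rewrite /off_dual in_setU1; case: eqVneq => [->|//].
by rewrite (negPf aJ) inE wa.
Qed.

End TurnerDouble.

(** * The generation theorem *)

Lemma fraction_char0 (O : idomainType) : [pchar {fraction O}] =i pred0 ->
  forall n, (0 < n)%N -> n%:R != 0 :> O.
Proof.
move=> char0 n n0; rewrite -(@tofrac_eq0 O) rmorph_nat ((pcharf0P _).1 char0).
by rewrite -lt0n.
Qed.

Section Main.
Variables (O : idomainType) (X : superalgebra O) (d : nat) (d_gt0 : (0 < d)%N).
Hypothesis charO : forall n, (0 < n)%N -> n%:R != 0 :> O.
Local Notation T := (T_alg X).
Local Notation L0 := [set i in X_letters X | ~~ par i].

Lemma tcast_spread m n (E : m = n) (y : T) : tcast E (spread m y) = spread n y.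
Proof. by case: n / E. Qed.

Lemma generatorsP (t : tensor T d) : generators d_gt0 t <->
  Inv (@in_X0 O X) t \/ exists2 y, in_Y y & t = spread d y.
Proof.
by split=> -[|[y yY ->]]; [left | right; exists y => //; rewrite spread_shuffle // tcast_spread
  | left | right; exists y => //; rewrite spread_shuffle // tcast_spread].
Qed.

Lemma in_X0_mul (x y : T) : in_X0 x -> in_X0 y -> in_X0 (x ** y).
Proof.
move=> [hx x0] [hy y0]; split; first exact: (smul_hom hx hy).
apply/lfunP => v; rewrite /= x0 y0 add_lfunE act_dualE dual_actE !zero_lfunE.
exact: addr0.
Qed.

Lemma tone_Inv : Inv (@in_X0 O X) (tone T d).
Proof.
apply/(InvP _ (@lets_X0 O X)); split.
  apply: (slots_pure (p := fun=> false)) => a; first exact: sone_hom.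
  by apply/lets_X0; split=> //; apply: sone_hom.
move=> g _; rewrite (tact_pure_hom g (fun=> sone_hom T)).
by rewrite (@actsgn_even _ _ _ _ setT) ?scale1r //; apply/subsetP => a; rewrite inE.
Qed.

(** The elements by which left multiplication preserves [induced L0] form a
subalgebra that contains the generators; apply each to 1, which is in
[induced L0]. *)
Lemma generated_induced (t : tensor T d) :
  subalg_gen (A := tensor_alg T d) (generators d_gt0) t -> induced L0 t.
Proof.
pose P (x : tensor T d) := forall y, induced L0 y -> induced L0 (tmul x y).
have Inv_induced x : Inv (@in_X0 O X) x -> induced L0 x.
  by move=> /(InvP _ (@lets_X0 O X))[Lx fx]; apply: induced_Inv.
move=> /(_ P) tP; rewrite -[t]tmul1r; apply: tP; last exact: Inv_induced tone_Inv.
- split=> [y|c x y Px Py z zL|x y Px Py z zL]; first by rewrite [tmul _ _]tmul1l.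
    by rewrite tmul_linl; apply: (@induced_submod _ _ _ L0).2; [apply: Px | apply: Py].
  by rewrite -[tmul _ _]tmulA; apply/Px/Py.
move=> x /generatorsP[/(InvP _ (@lets_X0 O X))[Lx fx] y|[y _ ->] z zL].
  apply: induced_Inv_tmul => // a b /lets_X0 a0 /lets_X0 b0.
  exact/lets_X0/in_X0_mul.
have [_ _ Z S] := lin_props (@spread_linear O T d).
rewrite (bas_sum y) S tmul_suml; apply: submod_sum => [|l _]; first exact: induced_submod.
have [_ _ Zl _] := lin_props (tmul_linl z).
rewrite Z Zl; apply: submodZ; first exact: induced_submod.
exact: (induced_spread_tmul charO (bas_hom l) zL).
Qed.

Lemma induced_generated (t : tensor T d) :
  induced L0 t -> subalg_gen (A := tensor_alg T d) (generators d_gt0) t.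
Proof.
move=> tL P [P1 Plin PM] Pgen.
have Psub : submodule (P : tensor T d -> Prop).
  split=> //; have := Plin (-1) _ _ P1 P1; by rewrite scaleN1r addNr.
have evenL i : i \in L0 -> par i = false by rewrite inE => /andP[_ /negPf].
apply: (induced_sub_closed charO evenL _ Psub) tL => [|s fs Ls|l s lL Ps].
- by apply/lets_X0; split=> //; apply: sone_hom.
- by apply/Pgen/generatorsP; left; apply/(InvP _ (@lets_X0 O X)).
apply: PM => //; apply/Pgen/generatorsP; right; exists (bas l) => //.
case: l lL => l lL i pi /=; last by rewrite /= linear0.
rewrite dbas_bas; have [il|//] := eqVneq i l; case/negP: lL.
by rewrite !inE -il /=; case: (par i) pi.
Qed.

(** The set [induced L] grows with L, which is the converse of
[induced_even]. *)
Lemma turner_doubleP (t : tensor T d) : turner_double t <-> induced L0 t.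
Proof.
split=> [/(turner_induced charO)/(induced_even charO)//|tL].
apply: (induced_turner charO); move: t tL; apply: lspan_ind; first exact: induced_submod.
move=> t [J [H [s [HJ Ls st]]]]; apply: (induced_gen HJ _ st).
apply: slots_sub Ls => a x Lx aJ i iX; apply: Lx => //.
by rewrite inE (negPf iX).
Qed.

End Main.

Theorem theorem4p30 (O : idomainType)
    (charO : [pchar {fraction O}] =i pred0)
    (X : superalgebra O) (d : nat) (d_gt0 : (0 < d)%N)
    (t : tensor (T_alg X) d) :
  turner_double t <->
  subalg_gen (A := tensor_alg (T_alg X) d) (generators d_gt0) t.
Proof.
have char0 := fraction_char0 charO.
split=> [/(turner_doubleP char0)|].
  exact: induced_generated.
by move=> /(generated_induced char0)/(turner_doubleP char0).
Qed.
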